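(* Let $\mathcal{H}$ be a real Hilbert space and $M:\mathcal{H}\to\mathcal{H}$ a monotone and continuous operator with $\mathrm{Zer}\,M\neq\emptyset$. Let $s_0>0$, $\alpha>1$, $\beta:[s_0,+\infty)\to(0,+\infty)$ a continuously differentiable function, and $z_0,\dot z_0\in\mathcal{H}$. Then $z:[s_0,+\infty)\to\mathcal{H}$ is the trajectory solution of $$\ddot z(s)+\frac{\alpha}{s}\dot z(s)+\beta(s)\frac{d}{ds}M(z(s))+\left(\dot\beta(s)+\frac{\beta(s)}{s}\right)M(z(s))=0$$ with initial conditions $z(s_0)=z_0$ and $\dot z(s_0)=\dot z_0$ if and only if it is the trajectory solution of $$\dot z(s)+\beta(s)M(z(s))+\frac{\alpha-1}{s}\,(z(s)-v)=0$$ with initial condition $z(s_0)=z_0$ and anchor point $$v:=z_0+\frac{s_0}{\alpha-1}\left(\dot z_0+\beta(s_0)M(z_0)\right).$$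
   Context: $M$ is monotone if $\langle M(x)-M(y),x-y\rangle\ge 0$ for all $x,y\in\mathcal{H}$; $\mathrm{Zer}\,M:=\{x\in\mathcal{H}:M(x)=0\}$. Trajectory solutions are (assumed unique) strong global solutions: for the second-order system, $z$ and $\dot z$ are absolutely continuous on every compact interval $[s_0,S]$, the equation holds almost everywhere together with the initial conditions, and $s\mapsto M(z(s))$ is absolutely continuous on every compact interval $[s_0,S]$; for the first-order system, $z$ is absolutely continuous on every compact interval $[s_0,S]$, the equation holds almost everywhere together with the initial condition, and $s\mapsto M(z(s))$ is absolutely continuous on every compact interval $[s_0,S]$. *)

(* Defs.v *)
From HB Require Import structures.
From mathcomp Require Import all_boot all_order all_algebra.
From mathcomp Require Import sesquilinear.
From mathcomp Require Import all_classical all_reals all_analysis.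

Set Implicit Arguments.
Unset Strict Implicit.
Unset Printing Implicit Defensive.

Import Order.TTheory GRing.Theory Num.Theory.
Import numFieldNormedType.Exports.
Local Open Scope classical_set_scope.
Local Open Scope ring_scope.

(* A real Hilbert space is a complete normed module H over R together with an
   inner product dot : {dot H for idfun} such that `|x| ^+ 2 = dot x x.       *)

Definition monotone_operator (R : realType) (H : completeNormedModType R)
    (dot : {dot H for idfun}) (M : H -> H) : Prop :=
  forall x y : H, 0 <= dot (M x - M y) (x - y).

Definition Zer (R : realType) (H : completeNormedModType R) (M : H -> H) :
  set H := [set x | M x = 0].

(* Functions on [s0, +oo[ are represented by total functions on R of which only
   the values on [s0, +oo[ matter. Differentiability is therefore taken
   relatively to [s0, +oo[: it is the usual two-sided notion at s > s0, and the
   one-sided one at s0.                                                       *)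
Definition derivable_from (R : realType) (V : normedModType R) (s0 : R)
    (f : R -> V) (s : R) : Prop :=
  cvg ((fun h : R => h^-1 *: (f (h + s) - f s))
         @ within [set h | s0 <= h + s] 0^').

Definition derive_from (R : realType) (V : normedModType R) (s0 : R)
    (f : R -> V) (s : R) : V :=
  lim ((fun h : R => h^-1 *: (f (h + s) - f s))
         @ within [set h | s0 <= h + s] 0^').

Definition C1_from (R : realType) (s0 : R) (f : R -> R) : Prop :=
  (forall s, s0 <= s -> derivable_from s0 f s) /\
  {within `[s0, +oo[, continuous (derive_from s0 f)}.

Definition abs_continuous (R : realType) (V : normedModType R) (a b : R)
    (f : R -> V) : Prop :=
  forall e : R, 0 < e -> exists2 d : R, 0 < d &
    forall (n : nat) (u v : 'I_n -> R),
      (forall i, [/\ a <= u i, u i <= v i & v i <= b]) ->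
      trivIset setT (fun i => `]u i, v i[%classic) ->
      \sum_(i < n) (v i - u i) < d ->
      \sum_(i < n) `|f (v i) - f (u i)| < e.

Definition loc_abs_continuous (R : realType) (V : normedModType R) (s0 : R)
    (f : R -> V) : Prop :=
  forall S : R, s0 <= S -> abs_continuous s0 S f.

(* That the equation holds at s includes the existence of all the derivatives
   occurring in it: lim is a junk value when the limit does not exist.        *)
Definition second_order_equation (R : realType) (H : completeNormedModType R)
    (M : H -> H) (alpha : R) (beta : R -> R) (s0 : R) (z : R -> H) (s : R) :
    Prop :=
  [/\ derivable_from s0 (derive_from s0 z) s,
      derivable_from s0 (M \o z) s &
      derive_from s0 (derive_from s0 z) s + (alpha / s) *: derive_from s0 z s
        + beta s *: derive_from s0 (M \o z) s
        + (derive_from s0 beta s + beta s / s) *: M (z s) = 0].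

Definition first_order_equation (R : realType) (H : completeNormedModType R)
    (M : H -> H) (alpha : R) (beta : R -> R) (s0 : R) (v : H) (z : R -> H)
    (s : R) : Prop :=
  derivable_from s0 z s /\
  derive_from s0 z s + beta s *: M (z s) + ((alpha - 1) / s) *: (z s - v) = 0.

Record strong_solution2 (R : realType) (H : completeNormedModType R)
    (M : H -> H) (alpha : R) (beta : R -> R) (s0 : R) (z0 dz0 : H)
    (z : R -> H) : Prop := StrongSolution2 {
  sol2_ac : loc_abs_continuous s0 z ;
  sol2_derivable : forall s, s0 <= s -> derivable_from s0 z s ;
  sol2_derive_ac : loc_abs_continuous s0 (derive_from s0 z) ;
  sol2_op_ac : loc_abs_continuous s0 (M \o z) ;
  sol2_eq : {ae (@lebesgue_measure R), forall s, s0 <= s ->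
               second_order_equation M alpha beta s0 z s} ;
  sol2_init : z s0 = z0 ;
  sol2_derive_init : derive_from s0 z s0 = dz0 }.

Record strong_solution1 (R : realType) (H : completeNormedModType R)
    (M : H -> H) (alpha : R) (beta : R -> R) (s0 : R) (v z0 : H)
    (z : R -> H) : Prop := StrongSolution1 {
  sol1_ac : loc_abs_continuous s0 z ;
  sol1_op_ac : loc_abs_continuous s0 (M \o z) ;
  sol1_eq : {ae (@lebesgue_measure R), forall s, s0 <= s ->
               first_order_equation M alpha beta s0 v z s} ;
  sol1_init : z s0 = z0 }.

(* Uniqueness only concerns the values on [s0, +oo[. *)
Definition the_solution (R : realType) (H : completeNormedModType R) (s0 : R)
    (sol : (R -> H) -> Prop) (z : R -> H) : Prop :=
  sol z /\ forall y, sol y -> forall s, s0 <= s -> y s = z s.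

Definition trajectory_solution2 (R : realType) (H : completeNormedModType R)
    (M : H -> H) (alpha : R) (beta : R -> R) (s0 : R) (z0 dz0 : H)
    (z : R -> H) : Prop :=
  the_solution s0 (strong_solution2 M alpha beta s0 z0 dz0) z.

Definition trajectory_solution1 (R : realType) (H : completeNormedModType R)
    (M : H -> H) (alpha : R) (beta : R -> R) (s0 : R) (v z0 : H)
    (z : R -> H) : Prop :=
  the_solution s0 (strong_solution1 M alpha beta s0 v z0) z.

(* Main.v *)
Require Import Defs.
From HB Require Import structures.
From mathcomp Require Import all_boot all_order all_algebra.
From mathcomp Require Import sesquilinear.
From mathcomp Require Import all_classical all_reals all_analysis.
From mathcomp Require Import measurable_realfun.
From mathcomp Require Import lra ring.
Import Order.TTheory GRing.Theory Num.Theory.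
Import numFieldNormedType.Exports.
Local Open Scope classical_set_scope.
Local Open Scope ring_scope.

Set Implicit Arguments.
Unset Strict Implicit.
Unset Printing Implicit Defensive.

(** For every z, being a strong solution of the second-order system and being a
    strong solution of the first-order one are equivalent; uniqueness then
    transfers by itself.

    From second to first order, the function
      F(s) = s z'(s) + s beta(s) M(z(s)) + (alpha - 1) z(s)
    is absolutely continuous, and F' is s times the left-hand side of the
    second-order equation, hence 0 almost everywhere. So F is constant
    (lemma ac_ae_deriv0), and F(s) = F(s0) = (alpha - 1) v is the first-order
    equation multiplied by s.

    From first to second order, z' agrees almost everywhere with
    g = - beta M(z) - ((alpha - 1) / s)(z - v), which is absolutely continuous,
    so z' = g everywhere (lemma ac_ae_deriv_everywhere). Differentiating g gives
    the second-order equation at every point where M(z) is differentiable. That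
    almost every point is such a point is the Radon-Nikodym property of Hilbert
    spaces (theorem ac_ae_has_deriv), proved here by an energy argument.

    Let f be absolutely continuous on [a, b] with values in a Hilbert space,
    and let l(t) = t + (variation of f on [a, t]), so that both |f(v) - f(u)| and
    v - u are at most l(v) - l(u). The energy |f(v) - f(u)|^2 / (l(v) - l(u))
    of an interval can only grow, in total, when a subdivision is refined, and
    it is bounded by l(b) - l(a). Take a subdivision whose energy is within eps
    of the supremum. On each cell, with slope m, the identity
      |x - c m|^2 = |x|^2 - 2 c <x, m> + c^2 |m|^2
    bounds the deviation |f(v) - f(u) - (l(v) - l(u)) m|^2 by
    (l(v) - l(u)) (Psi(v) - Psi(u)), where Psi is nondecreasing of total
    increment less than eps (lemma slope_control_small). A Vitali covering
    argument (lemma nondecreasing_weak_type) bounds the outer measure of the set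
    of points near which f oscillates by more than lam around every slope by
    3 eps / lam^2, for every eps. Hence the quotients of increments of f by those
    of l converge almost everywhere, and so do those of the identity; the latter
    limit is nonzero almost everywhere, again by the covering argument, and the
    derivative of f is the quotient of the two limits. *)

(** * Sums along subdivisions *)

(** The sum of F over the consecutive pairs of x :: s. When x :: s is
    nondecreasing, it is a subdivision of the interval from x to last x s, and F
    is seen as a function of its cells. *)
Fixpoint chain_sum (R : realType) (F : R -> R -> R) (x : R) (s : seq R) : R :=
  if s is y :: s' then F x y + chain_sum F y s' else 0.

Lemma chain_sum_cat (R : realType) (F : R -> R -> R) x s1 s2 :
  chain_sum F x (s1 ++ s2) = chain_sum F x s1 + chain_sum F (last x s1) s2.
Proof. by elim: s1 x => [|y s IH] x /=; rewrite ?add0r // IH addrA. Qed.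

Lemma chain_le_last (R : realType) (x : R) s : path <=%R x s -> x <= last x s.
Proof.
by elim: s x => [|y s IH] x //= /andP[xy /IH ys]; exact: le_trans ys.
Qed.

Lemma ler_chain_sum (R : realType) (F G : R -> R -> R) (a b x : R) s :
  (forall u v, a <= u -> u <= v -> v <= b -> F u v <= G u v) ->
  a <= x -> path <=%R x s -> last x s <= b ->
  chain_sum F x s <= chain_sum G x s.
Proof.
move=> FG; elim: s x => [|y s IH] x //= ax /andP[xy ys] sb.
apply: lerD; last by apply: IH => //; exact: le_trans xy.
by apply: FG => //; exact: le_trans (chain_le_last ys) sb.
Qed.

Lemma chain_sum_telescope (R : realType) (g : R -> R) x s :
  chain_sum (fun u v => g v - g u) x s = g (last x s) - g x.
Proof.
by elim: s x => [|y s IH] x /=; rewrite ?subrr // IH addrC addrA subrK.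
Qed.

(** An interval function F whose sums along subdivisions are bounded is
    dominated by the increments of a function e, namely the supremum e(t) of
    the sums of F from a to t, and the total increment of e is approached by
    such sums. *)
Lemma chain_majorant (R : realType) (F : R -> R -> R) (a b B : R) : a <= b ->
  (forall s, path <=%R a s -> last a s <= b -> chain_sum F a s <= B) ->
  exists e : R -> R,
    [/\ forall u v, a <= u -> u <= v -> v <= b -> F u v <= e v - e u,
        e b - e a <= B &
        forall eps, 0 < eps -> exists s,
          [/\ path <=%R a s, last a s = b &
              e b - e a - eps < chain_sum F a s]].
Proof.
move=> ab FB.
pose E t := [set chain_sum F a s | s in [set s | path <=%R a s /\ last a s = t]].
have Eub t : t <= b -> has_ubound (E t).
  by move=> tb; exists B => _ [s [ps ls] <-]; apply: FB => //; rewrite ls.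
have E0 t : a <= t -> E t !=set0.
  by move=> at_; exists (chain_sum F a [:: t]), [:: t] => //=; rewrite at_.
have Ea : 0 <= sup (E a) by apply: ub_le_sup; [exact: Eub|exists [::]].
have Eb : sup (E b) <= B.
  apply: ge_sup; first exact: E0.
  by move=> _ [s [ps ls] <-]; apply: FB => //; rewrite ls.
exists (fun t => sup (E t)); split.
- move=> u v au uv vb.
  rewrite lerBrDr addrC -lerBrDr; apply: ge_sup; first exact: E0.
  move=> _ [s [ps ls] <-]; rewrite lerBrDr.
  apply: ub_le_sup; first exact: Eub.
  exists (rcons s v).
    by split; rewrite ?rcons_path ?last_rcons // ps ls uv.
  by rewrite -cats1 chain_sum_cat /= ls addr0.
- by rewrite lerBlDr (le_trans Eb)// lerDl.
- move=> eps eps0.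
  have [|_ [s [ps ls] <-] sE] := @sup_adherent _ (E b) _ eps0.
    by split; [exact: E0|exact: Eub].
  by exists s; split => //; lra.
Qed.

(** Inserting the point c into a subdivision does not decrease the sum of a
    subadditive interval function. *)
Lemma chain_sum_split (R : realType) (F : R -> R -> R) (x c : R) s :
  (forall u v, u <= v -> 0 <= F u v) ->
  (forall u v w, u <= v -> v <= w -> F u w <= F u v + F v w) ->
  path <=%R x s -> x <= c ->
  exists s1 s2, [/\ path <=%R x s1, last x s1 <= c, path <=%R c s2,
    last c s2 <= Num.max c (last x s) &
    chain_sum F x s <= chain_sum F x s1 + chain_sum F c s2].
Proof.
move=> F0 Ft; elim: s x => [|y s IH] x /=.
  by move=> _ xc; exists [::], [::]; rewrite /= addr0 le_max lexx.
move=> /andP[xy ys] xc; have [yc|cy] := leP y c.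
  have [s1 [s2 [p1 l1 p2 l2 S]]] := IH y ys yc.
  exists (y :: s1), s2; split => //=; first by rewrite xy.
  by rewrite -addrA lerD2l.
exists [:: c], (y :: s); split => //=; first by rewrite xc.
- by rewrite (ltW cy).
- by rewrite le_max lexx orbT.
- by rewrite addr0 addrA lerD2r; apply: Ft => //; exact: ltW.
Qed.

(** A transitive relation between reals which holds around every point of a
    segment, between points on each side of it, holds between its ends. *)
Lemma local_to_global (R : realType) (T : R -> R -> Prop) (a b : R) : a <= b ->
  (forall u v w, u <= v -> v <= w -> T u v -> T v w -> T u w) ->
  (forall t, a <= t -> t <= b -> exists2 d, 0 < d &
     forall u v, a <= u -> t - d < u -> u <= t -> t <= v -> v < t + d ->
       v <= b -> T u v) ->
  T a b.
Proof.
move=> ab Ttr Tloc.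
pose E := [set t | [/\ a <= t, t <= b & T a t]].
have Ea : E a.
  split => //; have [d d0 Td] := Tloc a (lexx a) ab.
  by apply: Td; rewrite ?lexx //; lra.
have Es : has_sup E by split; [exists a|exists b => t []].
have as_ : a <= sup E by apply: ub_le_sup => //; case: Es.
have sb : sup E <= b by apply: ge_sup => [|t []//]; exists a.
have [d d0 Td] := Tloc _ as_ sb.
have [u [au ub Tu] su] := sup_adherent d0 Es.
have us : u <= sup E by apply: ub_le_sup => //; case: Es.
pose w := Num.min b (sup E + d / 2).
have sw : sup E <= w by rewrite le_min sb /=; lra.
have wb : w <= b by rewrite ge_min lexx.
have wd : w < sup E + d.
  by rewrite /w gt_min; apply/orP; right; lra.
have Tw : T a w.
  apply: (Ttr a u w) => //; first exact: le_trans us sw.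
  exact: Td.
have Ew : E w by split => //; exact: le_trans sw.
have ws : w <= sup E by apply: ub_le_sup => //; case: Es.
suff <- : w = b by [].
move: ws; rewrite /w; case: (leP b (sup E + d / 2)) => // _; lra.
Qed.

(** * Variation of absolutely continuous functions *)

Lemma chain_sumE (R : realType) (F : R -> R -> R) (x0 x : R) s :
  chain_sum F x s = \sum_(i < size s) F (nth x0 (x :: s) i) (nth x0 s i).
Proof.
elim: s x => [|y s IH] x; first by rewrite big_ord0.
by rewrite /= big_ord_recl /= IH.
Qed.

(** Absolute continuity in terms of subdivisions; p selects the cells that are
    taken into account. *)
Lemma ac_chain_sum (R : realType) (V : normedModType R) (f : R -> V) (a b : R) :
  abs_continuous a b f -> forall e, 0 < e -> exists2 d, 0 < d &
  forall (p : R -> R -> bool) x s, a <= x -> path <=%R x s -> last x s <= b ->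
    chain_sum (fun u v => if p u v then v - u else 0) x s < d ->
    chain_sum (fun u v => if p u v then `|f v - f u| else 0) x s < e.
Proof.
move=> acf e e0; have [d d0 fd] := acf e e0; exists d => // p x s ax ps sb.
pose u i := nth x (x :: s) i.
pose w i := nth x s i.
(* the cells that are not selected are replaced by empty intervals *)
pose v i := if p (u i) (w i) then w i else u i.
have uE i : w i = u i.+1 by [].
have um i j : (i <= j)%N -> (j <= size s)%N -> u i <= u j.
  move=> ij js; apply: (@sorted_leq_nth _ <=%R le_trans lexx x (x :: s) ps) => //=.
  by rewrite inE /= ltnS (leq_trans ij).
have vw i : (i < size s)%N -> v i <= w i.
  by move=> si; rewrite /v; case: ifP => // _; rewrite uE um.
have uv i : (i < size s)%N -> u i <= v i.
  by move=> si; rewrite /v; case: ifP => // _; rewrite uE um.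
rewrite !(chain_sumE _ x) => sd.
have := fd (size s) (fun i => u i) (fun i => v i).
rewrite (eq_bigr (fun i : 'I_(size s) =>
  if p (u i) (w i) then w i - u i else 0)); last first.
  by move=> i _; rewrite /v; case: ifP => //; rewrite subrr.
rewrite [X in _ -> _ -> _ -> X < _](eq_bigr (fun i : 'I_(size s) =>
  if p (u i) (w i) then `|f (w i) - f (u i)| else 0)); last first.
  by move=> i _; rewrite /v; case: ifP => //; rewrite subrr normr0.
apply => //.
- move=> i; split.
  + by apply: (le_trans ax); apply: (um 0%N) => //; exact: ltnW.
  + exact: uv.
  + apply: (le_trans (vw _ (ltn_ord i))); apply: le_trans sb.
    by rewrite uE (last_nth x); exact: um.
- apply/trivIsetP => i j _ _; wlog : i j / (i < j)%N.
    move=> wl ij; have [lt|lt|eq] := ltngtP i j; first exact: wl.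
    - by rewrite setIC; apply: wl; rewrite // eq_sym.
    - by move: ij; rewrite (val_inj eq) eqxx.
  move=> ij _; rewrite -subset0 => t [] /=; rewrite !in_itv /=.
  move=> /andP[_ tv] /andP[ut _].
  have := le_lt_trans (um i.+1 j ij (ltnW (ltn_ord j))) ut.
  by rewrite -uE => /(le_lt_trans (vw _ (ltn_ord i)))/(lt_trans tv); rewrite ltxx.
Qed.

Lemma ac_bounded_variation (R : realType) (V : normedModType R) (f : R -> V)
    (a b : R) : a <= b -> abs_continuous a b f ->
  exists B, forall s, path <=%R a s -> last a s <= b ->
    chain_sum (fun u v => `|f v - f u|) a s <= B.
Proof.
move=> ab acf; have [d d0 fd] := ac_chain_sum acf ltr01.
have {}fd x s : a <= x -> path <=%R x s -> last x s <= b ->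
    last x s - x < d -> chain_sum (fun u v => `|f v - f u|) x s <= 1.
  move=> ax ps sb sd; apply/ltW; apply: (fd (fun _ _ => true) x s) => //=.
  by rewrite (chain_sum_telescope id).
(* a subdivision of an interval of length k (d / 2) is cut every d / 2 *)
have fk k x s : a <= x -> path <=%R x s -> last x s <= b ->
    last x s <= x + k%:R * (d / 2) ->
    chain_sum (fun u v => `|f v - f u|) x s <= k%:R + 1.
  elim: k x s => [|k IH] x s ax ps sb sk.
    by rewrite add0r; apply: fd => //; move: sk; rewrite mul0r; lra.
  have [xc|cx] := leP (x + d / 2) b; last first.
    have : (1 : R) <= k.+1%:R + 1 by rewrite lerDr.
    by apply: le_trans; apply: fd => //; lra.
  have [|||s1 [s2 [p1 l1 p2 l2]]] :=
    @chain_sum_split R (fun u v => `|f v - f u|) x (x + d / 2) s _ _ ps _.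
  - by [].
  - by move=> u v w _ _ /=; rewrite [leRHS]addrC ler_distD.
  - lra.
  move/le_trans; apply; rewrite -[X in _ <= X + 1]natr1 [leRHS]addrC lerD //.
    by apply: fd => //; move: p1 => /chain_le_last; lra.
  apply: IH => //; first lra.
  - by apply: (le_trans l2); rewrite ge_max xc.
  - apply: (le_trans l2); rewrite ge_max lerDl mulr_ge0 ?ler0n//=; last lra.
    by apply: (le_trans sk); rewrite -(natr1 k); lra.
have q0 : 0 <= (b - a) / (d / 2) by rewrite divr_ge0; lra.
exists ((Num.bound ((b - a) / (d / 2)))%:R + 1) => s ps sb; apply: fk => //.
by have := archi_boundP q0; rewrite ltr_pdivrMr; lra.
Qed.

(** * Mean value inequality *)

Lemma chain_sum_in_open (R : realType) (U : set R) (x : R) s : open U ->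
  path <=%R x s ->
  ((chain_sum (fun u v => if `[< `[u, v] `<=` U >] then v - u else 0) x s)%:E
   <= @lebesgue_measure R (U `&` `]x, last x s]))%E.
Proof.
move=> oU; have mU : measurable U by exact: open_measurable.
elim: s x => [|y s IH] x /= ps; first exact: measure_ge0.
case/andP: ps => xy ps; have ys := chain_le_last ps.
have -> : U `&` `]x, last y s] =
    (U `&` `]x, y]) `|` (U `&` `]y, last y s]).
  rewrite -setIUr; congr (_ `&` _); rewrite -itv_bndbnd_setU //.
rewrite measureU; first last.
- rewrite -subset0 => t [[_ /=]]; rewrite in_itv /= => /andP[_ ty] [_ /=].
  by rewrite in_itv /= => /andP[/lt_le_trans/(_ ty)]; rewrite ltxx.
- by apply: measurableI.
- by apply: measurableI.
rewrite EFinD leeD ?IH//.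
case: asboolP => [xyU|_]; last exact: measure_ge0.
rewrite setIidr; last first.
  by apply: subset_trans xyU; apply: subset_itvr; rewrite ?bnd_simp.
have -> : (y - x)%:E = lebesgue_measure (`]x, y] : set R).
  rewrite lebesgue_measure_itv /= lte_fin -EFinB.
  by case: ltP => // yx; congr EFin; lra.
exact: lexx.
Qed.

(** Mean value inequality with an almost everywhere hypothesis. The exceptional
    set lies in an open set U of small measure; by absolute continuity the
    variation of f inside U is small, and it is recorded in the increments of
    a function g, which controls f around the exceptional points. *)
Lemma ac_ae_lipschitz (R : realType) (V : normedModType R) (f : R -> V)
    (a b K : R) : a <= b -> 0 <= K -> abs_continuous a b f ->
  {ae @lebesgue_measure R, forall t, a <= t -> t <= b ->
    forall e, 0 < e -> exists2 d, 0 < d & forall y, a <= y -> y <= b ->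
      `|y - t| < d -> `|f y - f t| <= (K + e) * `|y - t|} ->
  `|f b - f a| <= K * (b - a).
Proof.
move=> ab K0 acf /negligible_outer_measure.
set N := (~` _); move=> N0.
have main e : 0 < e -> `|f b - f a| <= (K + e) * (b - a) + e.
  move=> e0; have [d d0 fd] := ac_chain_sum acf e0.
  have d20 : 0 < d / 2 by lra.
  have [U [oU NU]] := outer_measure_open_le N d20.
  rewrite N0 add0e => Ud.
  pose F u v := if `[< `[u, v] `<=` U >] then `|f v - f u| else 0.
  have F0 u v : 0 <= F u v by rewrite /F; case: ifP.
  have FB s : path <=%R a s -> last a s <= b -> chain_sum F a s <= e.
    move=> ps sb; apply/ltW.
    apply: (fd (fun u v => `[< `[u, v] `<=` U >])) => //.
    rewrite -lte_fin; apply: (le_lt_trans (chain_sum_in_open oU ps)).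
    apply: (@le_lt_trans _ _ (d / 2)%:E); last by rewrite lte_fin; lra.
    apply: le_trans Ud; apply: le_measure; rewrite ?inE //.
    - by apply: measurableI => //; exact: open_measurable.
    - exact: open_measurable.
  have [g [gF gb _]] := chain_majorant ab FB.
  suff : `|f b - f a| <= (K + e) * (b - a) + (g b - g a) by lra.
  apply: (@local_to_global _ (fun u v =>
    `|f v - f u| <= (K + e) * (v - u) + (g v - g u))) => //.
    move=> u v w uv vw uvT vwT; have := ler_distD (f v) (f w) (f u).
    lra.
  move=> t at_ tb; have [tN|tN] := pselect (N t).
    have /nbhs_ballP[r /= r0 rU] := open_nbhs_nbhs (conj oU (NU _ tN)).
    exists (r / 2); first lra.
    move=> u v au tu ut tv vt vb.
    have := gF u v au (le_trans ut tv) vb; rewrite /F asboolT; last first.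
      move=> x /=; rewrite in_itv /= => /andP[ux xv]; apply: rU.
      by rewrite /ball /= ltr_norml; apply/andP; split; lra.
    have : 0 <= (K + e) * (v - u) by rewrite mulr_ge0; lra.
    lra.
  have /contrapT tP := tN; have [r r0 fr] := tP at_ tb e e0.
  exists r => // u v au tu ut tv vt vb.
  have := gF u v au (le_trans ut tv) vb; have := F0 u v.
  have := ler_distD (f t) (f v) (f u).
  have vt' : `|v - t| = v - t by rewrite ger0_norm; lra.
  have ut' : `|u - t| = t - u by rewrite distrC ger0_norm; lra.
  have := fr v (le_trans at_ tv) vb; rewrite vt' => Hv.
  have := fr u au (le_trans ut tb); rewrite ut' (distrC (f u)) => Hu.
  have {}/Hu : t - u < r by lra.
  have {}/Hv : v - t < r by lra.
  lra.
apply/ler_addgt0Pr => e e0.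
have D : 0 < b - a + 1 by lra.
have := main (e / (b - a + 1)) (divr_gt0 e0 D).
have : e / (b - a + 1) * (b - a + 1) = e by rewrite divfK // gt_eqF.
lra.
Qed.

(** * A covering estimate *)

Lemma sum_disjoint_increments (R : realType) (I : eqType) (E : seq I)
    (u v : I -> R) (Psi : R -> R) (a b : R) :
  a <= b ->
  (forall s t, a <= s -> s <= t -> t <= b -> Psi s <= Psi t) ->
  uniq E -> (forall i, i \in E -> [/\ a <= u i, u i < v i & v i <= b]) ->
  trivIset [set` E] (fun i => `]u i, v i[%classic) ->
  \sum_(i <- E) (Psi (v i) - Psi (u i)) <= Psi b - Psi a.
Proof.
have [n] := ubnP (size E); elim: n E a b => // n IH [|i E] a b /=.
  by move=> _ ab mP _ _ _; rewrite big_nil subr_ge0 mP.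
rewrite ltnS => En ab mP /andP[iE uE] uvE tE.
have [aui uvi vib] := uvE i (mem_head _ _).
rewrite big_cons (bigID (fun j => v j <= u i)) /=.
rewrite -[X in _ + (X + _)]big_filter -[X in _ + (_ + X)]big_filter.
have EE (p : pred I) j : j \in [seq j <- E | p j] -> j \in E by rewrite mem_filter => /andP[].
have sE (p : pred I) : (size [seq j <- E | p j] < n)%N.
  by apply: leq_ltn_trans En; rewrite size_filter count_size.
have tE' (p : pred I) : trivIset [set` [seq j <- E | p j]] (fun i => `]u i, v i[%classic).
  apply: sub_trivIset tE => j /= /EE jE; by rewrite inE jE orbT.
have mem j : j \in E -> j \in i :: E by move=> jE; rewrite inE jE orbT.
have L := IH [seq j <- E | v j <= u i] a (u i) (sE _) aui.
have {}L : \sum_(j <- [seq j <- E | v j <= u i]) (Psi (v j) - Psi (u j))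
    <= Psi (u i) - Psi a.
  apply: L => //; last 2 first.
  - by rewrite filter_uniq.
  - move=> j; rewrite mem_filter => /andP[vj jE].
    by have [? ? _] := uvE j (mem _ jE).
  - by move=> s t as_ st tu; apply: mP => //; lra.
have H := IH [seq j <- E | ~~ (v j <= u i)] (v i) b (sE _) vib.
have {}H : \sum_(j <- [seq j <- E | ~~ (v j <= u i)]) (Psi (v j) - Psi (u j))
    <= Psi b - Psi (v i).
  apply: H => //; last 2 first.
  - by rewrite filter_uniq.
  - move=> j; rewrite mem_filter -ltNge => /andP[vj jE].
    have [? uvj ?] := uvE j (mem _ jE); split => //.
    rewrite leNgt; apply/negP => uv.
    have ij : i = j; last by move: iE; rewrite ij jE.
    apply: tE => /=; [exact: mem_head|exact: mem|].
    exists ((Num.max (u i) (u j) + Num.min (v i) (v j)) / 2).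
    by split; rewrite /= in_itv /=; case: (leP (u i) (u j)) => ?;
      case: (leP (v i) (v j)) => ?; apply/andP; split; lra.
  - by move=> s t as_ st tu; apply: mP => //; lra.
lra.
Qed.

(** The points lying in some interval, within ]a, b[, on which a nondecreasing
    Psi has mean slope larger than c form a set of outer measure at most
    3 (Psi(b) - Psi(a)) / c. *)
Lemma nondecreasing_weak_type (R : realType) (Psi : R -> R) (a b c : R)
    (A : set R) : a <= b -> 0 < c ->
  (forall s t, a <= s -> s <= t -> t <= b -> Psi s <= Psi t) ->
  (forall t, A t -> exists u v, [/\ a < u < v, v < b, u <= t <= v &
     c * (v - u) < Psi v - Psi u]) ->
  ((wlength idfun)^*%mu A <= (3 * (Psi b - Psi a) / c)%:E)%E.
Proof.
move=> ab c0 mP AP.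
(* balls are indexed by center and radius; rad makes every index valid *)
pose rad (i : R * R) := if 0 < i.2 then i.2 else 1.
pose B (i : R * R) : set R := ball i.1 (rad i).
have rad0 i : 0 < rad i by rewrite /rad; case: ifP.
pose D0 := [set i : R * R | [/\ a <= i.1 - rad i, i.1 + rad i <= b &
  c * (2 * rad i) <= Psi (i.1 + rad i) - Psi (i.1 - rad i)]].
pose O := cover D0 B.
have oO : open O by apply: bigcup_open => i _; exact: ball_open.
have AO : A `<=` O.
  move=> t /AP [u [v [/andP[au uv] vb /andP[ut tv] cP]]].
  (* [u, v] is enlarged by d to an open interval still of large slope *)
  pose d := Num.min (Num.min (u - a) (b - v))
    ((Psi v - Psi u - c * (v - u)) / (2 * c)).
  have d0 : 0 < d by rewrite !lt_min divr_gt0; lra.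
  have da : d <= u - a by rewrite /d !ge_min lexx.
  have db : d <= b - v by rewrite /d !ge_min lexx orbT.
  have dP : c * (2 * d) <= Psi v - Psi u - c * (v - u).
    have : d <= (Psi v - Psi u - c * (v - u)) / (2 * c).
      by rewrite /d !ge_min lexx orbT.
    by rewrite ler_pdivlMr; lra.
  have rE : rad ((u + v) / 2, (v - u) / 2 + d) = (v - u) / 2 + d.
    by rewrite /rad /=; case: ifP => // /negP[]; lra.
  have uE : (u + v) / 2 - ((v - u) / 2 + d) = u - d by lra.
  have vE : (u + v) / 2 + ((v - u) / 2 + d) = v + d by lra.
  exists ((u + v) / 2, (v - u) / 2 + d).
    rewrite /D0 /= rE uE vE; split; try lra.
    have : Psi v <= Psi (v + d) by apply: mP; lra.
    have : Psi (u - d) <= Psi u by apply: mP; lra.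
    lra.
  by rewrite /B rE /ball /= ltr_norml; apply/andP; split; lra.
apply: (@le_trans _ _ ((wlength idfun)^*%mu O)); first exact: le_outer_measure.
rewrite -[leLHS]/(lebesgue_measure O).
rewrite lebesgue_regularity_inner_sup; last exact: open_measurable.
apply: ge_ereal_sup => /= x /= [K [cK KO <-{x}]].
have [D Dsub Kcover] : finite_subset_cover D0 B K.
  move: cK; rewrite compact_cover; apply => //.
  by move=> i _; exact: ball_open.
have is_ballB i : is_ball (B i) by exact: is_ball_ball.
have Bset0 i : B i !=set0 by exists i.1; exact: ballxx.
have [E [uE ED tEB DE]] := @vitali_lemma_finite_cover _ (R * R)%type B is_ballB Bset0 (finmap.enum_fset D).
have {}DE := subset_trans Kcover DE.
apply: (@le_trans _ _ (\sum_(i <- E) (3 * (2 * rad i))%:E)%E).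
  have -> : (\sum_(i <- E) (3 * (2 * rad i))%:E =
             \sum_(i <- E) lebesgue_measure (3 *` B i))%E.
    apply: eq_bigr => i _; rewrite scale_ballE // lebesgue_measure_ball.
      by congr EFin; rewrite mulr2n; lra.
    by rewrite mulr_ge0 // ltW.
  apply: (le_trans (@content_subadditive _ _ _ lebesgue_measure K
      (fun i => 3 *` B (nth (0, 0) E i)) (size E) _ _ _)) => //.
  - by move=> k ?; rewrite scale_ballE//; exact: measurable_ball.
  - exact: (compact_measurable cK).
  - apply: (subset_trans DE); rewrite /cover bigcup_seq.
    by rewrite (big_nth (0, 0))//= big_mkord.
  - by rewrite (big_nth (0, 0)) big_mkord.
rewrite sumEFin lee_fin ler_pdivlMr // mulr_suml.
apply: (@le_trans _ _ (\sum_(i <- E)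
    3 * (Psi (i.1 + rad i) - Psi (i.1 - rad i)))).
  rewrite [leLHS]big_seq [leRHS]big_seq; apply: ler_sum => i /ED /Dsub.
  rewrite inE => -[_ _]; lra.
rewrite -mulr_sumr ler_pM2l //.
apply: (sum_disjoint_increments ab mP uE).
  by move=> i /ED /Dsub; rewrite inE => -[? ? _]; have := rad0 i; split => //; lra.
have -> : (fun i : R * R => `]i.1 - rad i, i.1 + rad i[%classic) = B.
  by apply/funext => i; rewrite /B ball_itv.
exact: tEB.
Qed.

(** * Energy of a function relative to an increasing function *)

(** ip is an inner product inducing the norm of V. *)
Record inner_product (R : realType) (V : normedModType R)
    (ip : V -> V -> R) : Prop := InnerProduct {
  ip_norm : forall x, `|x| ^+ 2 = ip x x ;
  ip_sym : forall x y, ip x y = ip y x ;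
  ip_sub : forall x y z, ip (x - y) z = ip x z - ip y z ;
  ip_scale : forall c x z, ip (c *: x) z = c * ip x z }.

Lemma sqr_norm_subZ (R : realType) (V : normedModType R) (ip : V -> V -> R)
    (x m : V) (c : R) : inner_product ip ->
  `|x - c *: m| ^+ 2 = `|x| ^+ 2 - 2 * c * ip x m + c ^+ 2 * ip m m.
Proof.
move=> [ipN ipC ipB ipZ]; rewrite !ipN ipB ipZ (ipC x) (ipC m (x - _)) !ipB !ipZ.
rewrite (ipC m x); ring.
Qed.

(** Outside a finite set E, the increments of f around each point of ]x, y[ are
    close to those of m l for some slope m; the squared deviation is controlled
    by a nondecreasing function Psi of total increment c. *)
Definition slope_control (R : realType) (V : normedModType R) (f : R -> V)
    (l : R -> R) (x y c : R) : Prop :=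
  exists (Psi : R -> R) (E : seq R),
  [/\ forall u v, x <= u -> u <= v -> v <= y -> Psi u <= Psi v,
      Psi y - Psi x = c &
      forall t, x < t -> t < y -> t \notin E -> exists m, exists2 d, 0 < d &
        forall u v, t - d < u -> u <= v -> v < t + d ->
          `|f v - f u - (l v - l u) *: m| ^+ 2 <= (l v - l u) * (Psi v - Psi u)].

(** The two control functions are glued at y, and y joins the exceptional
    points. *)
Lemma slope_control_trans (R : realType) (V : normedModType R) (f : R -> V)
    (l : R -> R) (x y z c d : R) : x <= y -> y <= z ->
  slope_control f l x y c -> slope_control f l y z d ->
  slope_control f l x z (c + d).
Proof.
move=> xy yz [P1 [E1 [m1 <- s1]]] [P2 [E2 [m2 <- s2]]].
pose P t := if t <= y then P1 t - P1 y + P2 y else P2 t.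
have Pl t : t <= y -> P t = P1 t - P1 y + P2 y by rewrite /P => ->.
have Pr t : y <= t -> P t = P2 t.
  rewrite /P le_eqVlt => /predU1P[->|yt]; first by rewrite lexx subrr add0r.
  by rewrite leNgt yt.
exists P, (y :: E1 ++ E2); split.
- move=> u v xu uv vz; have [vy|yv] := leP v y.
    by rewrite !Pl ?lerD2r ?m1 // (le_trans uv).
  rewrite (Pr v (ltW yv)); have [uy|yu] := leP u y; last first.
    by rewrite (Pr u (ltW yu)) m2 // ltW.
  rewrite Pl //; have := m1 u y xu uy (lexx y).
  have := m2 y v (lexx y) (ltW yv) vz; lra.
- rewrite (Pr z) // (Pl x) //; ring.
- move=> t xt tz; rewrite inE mem_cat !negb_or => /and3P[ty tE1 tE2].
  move: ty; rewrite neq_lt => /orP[ty|yt].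
  + have [m [d0 d00 dm]] := s1 t xt ty tE1; exists m.
    exists (Num.min d0 (y - t)); first by rewrite lt_min d00 subr_gt0.
    move=> u v; rewrite ltrBlDr -ltrBlDl => + uv.
    rewrite -ltrBlDl !lt_min => /andP[? ?] /andP[? ?].
    have uy : u <= y by lra.
    have vy : v <= y by lra.
    have := dm u v; rewrite (Pl u) // (Pl v) //.
    have -> : P1 v - P1 y + P2 y - (P1 u - P1 y + P2 y) = P1 v - P1 u by ring.
    by apply; lra.
  + have [m [d0 d00 dm]] := s2 t yt tz tE2; exists m.
    exists (Num.min d0 (t - y)); first by rewrite lt_min d00 subr_gt0.
    move=> u v; rewrite ltrBlDr -ltrBlDl => + uv.
    rewrite -ltrBlDl !lt_min => /andP[? ?] /andP[? ?].
    have yu : y <= u by lra.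
    have yv : y <= v by lra.
    have := dm u v; rewrite (Pr u) // (Pr v) //.
    by apply; lra.
Qed.

Section energy.
Variables (R : realType) (V : normedModType R) (ip : V -> V -> R).
Hypothesis ipP : inner_product ip.
Variables (f : R -> V) (l : R -> R) (a b : R).
Hypothesis ab : a <= b.
Hypothesis l_expand : forall u v, a <= u -> u <= v -> v <= b ->
  v - u <= l v - l u.
Hypothesis f_le : forall u v, a <= u -> u <= v -> v <= b ->
  `|f v - f u| <= l v - l u.

(** The energy of the interval [u, v]. If l(u) = l(v), then f(u) = f(v) and the
    quotient is 0, as division by 0 gives 0. *)
Definition energy u v := `|f v - f u| ^+ 2 / (l v - l u).

Lemma energyK u v : a <= u -> u <= v -> v <= b ->
  (l v - l u) * energy u v = `|f v - f u| ^+ 2.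
Proof.
move=> au uv vb; rewrite /energy mulrCA; have := l_expand au uv vb.
have [<-|uv'] := eqVneq u v; first by rewrite !subrr normr0 expr0n /= mul0r.
move=> lv; rewrite divff ?mulr1 // gt_eqF //; apply: lt_le_trans lv.
by rewrite subr_gt0 lt_neqAle uv'.
Qed.

Lemma energy_le u v : a <= u -> u <= v -> v <= b -> energy u v <= l v - l u.
Proof.
move=> au uv vb; have H := f_le au uv vb.
have l0 : 0 <= l v - l u by apply: le_trans H.
rewrite /energy; have [->|n0] := eqVneq (l v - l u) 0; first by rewrite invr0 mulr0.
rewrite ler_pdivrMr ?lt_def ?n0 //.
by rewrite expr2 ler_pM.
Qed.

(** On a single cell [x, y], take the mean slope m of f and
    Psi = e - 2 <f, m> + l |m|^2, with total increment the defect of energy of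
    the cell. *)
Lemma slope_control_cell (e : R -> R) x y :
  (forall u v, a <= u -> u <= v -> v <= b -> energy u v <= e v - e u) ->
  a <= x -> x <= y -> y <= b ->
  slope_control f l x y (e y - e x - energy x y).
Proof.
move=> He ax xy yb.
pose m := (l y - l x)^-1 *: (f y - f x).
pose P t := e t - 2 * ip (f t) m + l t * ip m m.
have D u v : x <= u -> u <= v -> v <= y ->
  `|f v - f u - (l v - l u) *: m| ^+ 2 <= (l v - l u) * (P v - P u).
  move=> xu uv vy.
  have au := le_trans ax xu; have vb := le_trans vy yb.
  have H := He u v au uv vb; have := energyK au uv vb.
  have := l_expand au uv vb => lv.
  rewrite (sqr_norm_subZ _ _ _ ipP) => <-.
  have -> : P v - P u = (e v - e u) - 2 * ip (f v - f u) m + (l v - l u) * ip m m.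
    by rewrite /P (ip_sub ipP); ring.
  have : (l v - l u) * energy u v <= (l v - l u) * (e v - e u).
    by rewrite ler_wpM2l //; lra.
  lra.
exists P, [::]; split.
- move=> u v xu uv vy; have := D u v xu uv vy.
  have [<-//|uv'] := eqVneq u v.
  have ltuv : u < v by rewrite lt_neqAle uv'.
  have := l_expand (le_trans ax xu) uv (le_trans vy yb) => lv.
  move=> /(le_trans (sqr_ge0 _)); rewrite pmulr_rge0; lra.
- have -> : P y - P x = (e y - e x) - 2 * ip (f y - f x) m + (l y - l x) * ip m m.
    by rewrite /P (ip_sub ipP); ring.
  have mE : (l y - l x) *: m = f y - f x.
    rewrite /m scalerA; have := l_expand ax xy yb.
    have [<-|xy'] := eqVneq x y; first by rewrite !subrr mul0r scale0r.
    have xy2 : x < y by rewrite lt_neqAle xy'.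
    by move=> lv; rewrite divff ?scale1r // gt_eqF //; lra.
  have -> : ip (f y - f x) m = (l y - l x) * ip m m by rewrite -{1}mE (ip_scale ipP).
  have -> : energy x y = (l y - l x) * ip m m.
    rewrite /energy (ip_norm ipP) -{1}mE (ip_scale ipP).
    rewrite mulrC mulrA; rewrite (ip_sym ipP m) /m !(ip_scale ipP); ring.
  by ring.
- move=> t xt ty _; exists m; exists (Num.min (t - x) (y - t)).
    by rewrite lt_min !subr_gt0 xt.
  move=> u v; rewrite ltrBlDr -ltrBlDl => + uv.
  rewrite -ltrBlDl !lt_min => /andP[? ?] /andP[? ?].
  by apply: D; lra.
Qed.

Lemma slope_control_chain (e : R -> R) x s :
  (forall u v, a <= u -> u <= v -> v <= b -> energy u v <= e v - e u) ->
  a <= x -> path <=%R x s -> last x s <= b ->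
  slope_control f l x (last x s) (e (last x s) - e x - chain_sum energy x s).
Proof.
move=> He; elim: s x => [|y s IH] x /= ax.
  move=> _ xb; have := slope_control_cell He ax (lexx x) xb.
  by rewrite [energy x x]/energy !subrr normr0 expr0n /= mul0r subrr.
move=> /andP[xy ps] sb; have ys := chain_le_last ps.
have := slope_control_trans xy ys
  (slope_control_cell He ax xy (le_trans ys sb))
  (IH y (le_trans ax xy) ps sb).
by congr slope_control; ring.
Qed.

Lemma slope_control_small eps : 0 < eps ->
  exists2 c, c < eps & slope_control f l a b c.
Proof.
move=> eps0.
have B s : path <=%R a s -> last a s <= b -> chain_sum energy a s <= l b - l a.
  move=> ps sb; apply: (@le_trans _ _ (l (last a s) - l a)).
    rewrite -(chain_sum_telescope l); apply: (ler_chain_sum _ (lexx a) ps sb).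
    exact: energy_le.
  have := l_expand (chain_le_last ps) sb (lexx b); lra.
have [e [He _ He2]] := chain_majorant ab B.
have [s [ps ls sE]] := He2 eps eps0.
exists (e b - e a - chain_sum energy a s); first lra.
have := slope_control_chain He (lexx a) ps; rewrite ls; exact.
Qed.

End energy.

(** * Almost everywhere existence of slopes *)

(** Near t, the increments of f over intervals containing t are those of m l, up
    to a relative error lam. *)
Definition slope_at (R : realType) (V : normedModType R) (f : R -> V)
    (l : R -> R) (t lam : R) (m : V) : Prop :=
  exists2 d, 0 < d & forall u v, t - d < u -> u <= t -> t <= v -> v < t + d ->
    `|f v - f u - (l v - l u) *: m| <= lam * (l v - l u).

Lemma slope_ae (R : realType) (V : normedModType R) (ip : V -> V -> R)
    (f : R -> V) (l : R -> R) (a b lam : R) : inner_product ip ->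
  a <= b ->
  (forall u v, a <= u -> u <= v -> v <= b -> v - u <= l v - l u) ->
  (forall u v, a <= u -> u <= v -> v <= b -> `|f v - f u| <= l v - l u) ->
  0 < lam ->
  (@lebesgue_measure R).-negligible
    [set t | a < t < b /\ forall m, ~ slope_at f l t lam m].
Proof.
move=> ipP ab lE fl lam0; apply/negligible_outer_measure.
set A := (X in _^*%mu X).
apply/eqP; rewrite eq_le outer_measure_ge0 andbT.
apply/lee_addgt0Pr => e e0; rewrite add0e.
have e1 : 0 < e * lam ^+ 2 / 3 by rewrite divr_gt0 // mulr_gt0 // exprn_gt0.
have [c ce [Psi [E [mP Pc sP]]]] := slope_control_small ipP ab lE fl e1.
have l20 : 0 < lam ^+ 2 by rewrite exprn_gt0.
have AE : A `<=` (A `\` [set` E]) `|` [set` E].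
  by move=> t At; have [tE|tE] := pselect ([set` E] t); [right|left].
apply: (@le_trans _ _ ((wlength idfun)^*%mu ((A `\` [set` E]) `|` [set` E]))).
  exact: le_outer_measure.
apply: (le_trans (outer_measureU2 _ _ _)).
have E0 : lebesgue_measure ([set` E] : set R) = 0%E.
  apply: countable_lebesgue_measure0; apply: finite_set_countable.
  exact: finite_seq.
rewrite [X in (_ + X)%E](_ : _ = 0%E); last exact: E0.
rewrite adde0.
apply: (@le_trans _ _ (3 * (Psi b - Psi a) / lam ^+ 2)%:E); last first.
  rewrite lee_fin ler_pdivrMr // Pc.
  by move: ce; rewrite ltr_pdivlMr //; lra.
apply: (nondecreasing_weak_type ab l20 mP) => t [[/andP[at_ tb] At] tE].
have [m [d d0 dm]] := sP t at_ tb (introN idP tE).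
pose d' := Num.min d (Num.min (t - a) (b - t)).
have d'0 : 0 < d' by rewrite !lt_min d0 !subr_gt0 at_.
have d'd : d' <= d by rewrite /d' ge_min lexx.
have d'a : d' <= t - a by rewrite /d' !ge_min lexx orbT.
have d'b : d' <= b - t by rewrite /d' !ge_min lexx !orbT.
have := At m; move/forall2NP => /(_ d') [//|].
move=> /existsNP[u /existsNP[v]].
move=> /not_implyP[tu /not_implyP[ut /not_implyP[tv /not_implyP[vt]]]].
move/negP; rewrite -ltNge => H.
have uv := le_trans ut tv.
have {dm} := dm u v _ uv _ => /(_ ltac:(lra) ltac:(lra)) D.
have au : a <= u by lra.
have vb : v <= b by lra.
have luv := lE u v au uv vb.
have [uv0|uv0] := eqVneq u v.
  by move: H; rewrite uv0 !subrr scale0r subrr normr0 mulr0 ltxx.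
have {}uv0 : u < v by rewrite lt_neqAle uv0.
have l0 : 0 < l v - l u by lra.
have ll0 : 0 <= lam * (l v - l u) by apply: mulr_ge0; exact: ltW.
(* lam^2 (v - u) <= lam^2 (l v - l u) < Psi v - Psi u *)
have H2 : (lam * (l v - l u)) ^+ 2 < `|f v - f u - (l v - l u) *: m| ^+ 2.
  by rewrite ltr_pXn2r ?nnegrE.
have {H2 D} := lt_le_trans H2 D.
rewrite exprMn [in X in X -> _]expr2 mulrA [X in X < _]mulrC ltr_pM2l //.
move=> H2.
exists u, v; split.
- by rewrite uv0 andbT; lra.
- lra.
- by rewrite ut tv.
apply: le_lt_trans H2; exact: ler_wpM2l (ltW l20) _ _ luv.
Qed.

(** Approximate slopes of increasing accuracy form a Cauchy sequence, whose limit
    is an exact slope. *)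
Lemma slope_limit (R : realType) (V : completeNormedModType R) (f : R -> V)
    (l : R -> R) (a b t : R) : a < t -> t < b ->
  (forall u v, a <= u -> u < v -> v <= b -> l u < l v) ->
  (forall k : nat, exists m, slope_at f l t k.+1%:R^-1 m) ->
  exists g, forall lam, 0 < lam -> slope_at f l t lam g.
Proof.
move=> at_ tb lt H.
pose r k : R := k.+1%:R^-1.
have {}H k : exists m, slope_at f l t (r k) m by exact: H.
have r0 k : 0 < r k by rewrite invr_gt0.
have rD j k : (j <= k)%N -> r k <= r j.
  by move=> jk; rewrite /r lef_pV2 ?posrE // ler_nat ltnS.
have small e : 0 < e -> exists k, r k < e.
  move=> e0; have [N _ HN] := near_infty_natSinv_lt (PosNum e0).
  by exists N; apply: HN => /=.
move: r H r0 rD small => r /choice[m mP] r0 rD small.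
have mm i j : `|m i - m j| <= r i + r j.
  have [d1 d10 H1] := mP i; have [d2 d20 H2] := mP j.
  have [D [D0 Dd1 Dd2 Db]] : exists D, [/\ 0 < D, D <= d1, D <= d2 & D <= b - t].
    exists (Num.min (Num.min d1 d2) (b - t)).
    by rewrite !lt_min d10 d20 subr_gt0 tb !ge_min !lexx ?orbT.
  pose v := t + D / 2.
  have tv : t < v by rewrite /v; lra.
  have ltv : 0 < l v - l t by rewrite subr_gt0 lt //; rewrite ?/v; lra.
  have td1 : t - d1 < t by rewrite gtrBl.
  have td2 : t - d2 < t by rewrite gtrBl.
  have vd1 : v < t + d1 by rewrite /v; lra.
  have vd2 : v < t + d2 by rewrite /v; lra.
  have K1 := H1 t v td1 (lexx t) (ltW tv) vd1.
  have K2 := H2 t v td2 (lexx t) (ltW tv) vd2.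
  rewrite -(ler_pM2l ltv).
  have -> : (l v - l t) * `|m i - m j| =
      `|(l v - l t) *: m i - (l v - l t) *: m j|.
    by rewrite -scalerBr normrZ gtr0_norm.
  have := ler_distD (f v - f t) ((l v - l t) *: m i) ((l v - l t) *: m j).
  rewrite (distrC _ (f v - f t)) => /le_trans; apply.
  by rewrite mulrDr lerD // mulrC.
have cm : cauchy (m @ \oo).
  apply: cauchy_exP => e e0; have [k ke] := small (e / 2) ltac:(lra).
  exists (m k); exists k => // n /= kn.
  rewrite -ball_normE /ball_ /=; apply: (le_lt_trans (mm k n)).
  have := rD k n kn.
  lra.
have /cauchy_cvgP/cvg_ex[/= g mg] := cm.
have gm k : `|m k - g| <= r k.
  apply/ler_addgt0Pr => e e0.
  have /cvgrPdist_lt/(_ (e / 2) ltac:(lra))[N _ HN] := mg.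
  have [j je] := small (e / 2) ltac:(lra).
  pose n := maxn N j.
  have := HN n (leq_maxl _ _); have := mm k n.
  have := rD j n (leq_maxr _ _).
  have := ler_distD (m n) (m k) g; rewrite (distrC g); lra.
exists g => lam lam0; have [k ke] := small (lam / 2) ltac:(lra).
have [d d0 dP] := mP k.
exists (Num.min d (Num.min (t - a) (b - t))).
  by rewrite !lt_min d0 !subr_gt0 at_.
have d'd : Num.min d (Num.min (t - a) (b - t)) <= d by rewrite ge_min lexx.
have d'a : Num.min d (Num.min (t - a) (b - t)) <= t - a.
  by rewrite !ge_min lexx orbT.
have d'b : Num.min d (Num.min (t - a) (b - t)) <= b - t.
  by rewrite !ge_min lexx !orbT.
move=> u v tu ut tv vt.
have luv : 0 <= l v - l u.
  have [->|uv] := eqVneq u v; first by rewrite subrr.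
  have uv' : u < v by rewrite lt_neqAle uv (le_trans ut).
  by rewrite subr_ge0 ltW // lt //; lra.
have tu' : t - d < u by lra.
have vt' : v < t + d by lra.
have K := dP u v tu' ut tv vt'.
have G : `|(l v - l u) *: m k - (l v - l u) *: g| <= (l v - l u) * r k.
  by rewrite -scalerBr normrZ ger0_norm // ler_wpM2l.
have C : (l v - l u) * r k <= (l v - l u) * (lam / 2).
  by rewrite ler_wpM2l // ltW.
have := ler_distD ((l v - l u) *: m k) (f v - f u) ((l v - l u) *: g); lra.
Qed.

(** * Differentiability of absolutely continuous functions *)

(** L is the derivative of f at s relative to [s0, +oo[. *)
Definition has_deriv_from (R : realType) (V : normedModType R) (s0 : R)
    (f : R -> V) (s : R) (L : V) : Prop :=
  forall e : R, 0 < e -> exists2 d : R, 0 < d & forall y, s0 <= y ->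
    `|y - s| < d -> `|f y - f s - (y - s) *: L| <= e * `|y - s|.

(** The identity seldom has slope 0 relative to l: where it does, l has
    arbitrarily large mean slopes. *)
Lemma degenerate_slope_negligible (R : realType) (l : R -> R) (a b : R) :
  a <= b -> (forall u v, a <= u -> u < v -> v <= b -> l u < l v) ->
  (@lebesgue_measure R).-negligible [set t | a < t < b /\
    forall lam : R, 0 < lam -> slope_at (id : R -> R^o) l t lam 0].
Proof.
move=> ab lt; apply/negligible_outer_measure.
set A := (X in _^*%mu X).
apply/eqP; rewrite eq_le outer_measure_ge0 andbT.
apply/lee_addgt0Pr => e e0; rewrite add0e.
have lle s t : a <= s -> s <= t -> t <= b -> l s <= l t.
  move=> as_; rewrite le_eqVlt => /predU1P[->//|st] tb; exact/ltW/lt.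
have lab : 0 <= l b - l a by rewrite subr_ge0 lle.
pose c := 3 * (l b - l a) / e + 1.
have c0 : 0 < c by rewrite ltr_wpDl // divr_ge0 ?mulr_ge0 // ltW.
apply: (@le_trans _ _ (3 * (l b - l a) / c)%:E); last first.
  have cE : e * c = 3 * (l b - l a) + e by rewrite /c; field; rewrite gt_eqF.
  by rewrite lee_fin ler_pdivrMr // cE lerDl ltW.
apply: (nondecreasing_weak_type ab c0 lle) => t [/andP[at_ tb] At].
have l0 : 0 < (2 * c)^-1 by rewrite invr_gt0; lra.
have [d d0 dP] := At _ l0.
have [D [D0 Dd Db]] : exists D, [/\ 0 < D, D <= d & D <= b - t].
  by exists (Num.min d (b - t)); rewrite lt_min d0 subr_gt0 tb !ge_min !lexx orbT.
have := dP t (t + D / 2); rewrite scaler0 subr0 => H.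
have {H} : `|t + D / 2 - t| <= (2 * c)^-1 * (l (t + D / 2) - l t).
  by apply: H; lra.
have tD : t < t + D / 2 by lra.
rewrite ger0_norm; last lra.
rewrite ler_pdivlMl; last lra.
have : l t < l (t + D / 2) by apply: lt; lra.
move=> l1 l2; exists t, (t + D / 2); split.
- by rewrite at_ tD.
- lra.
- by rewrite lexx ltW.
- by move: l2; lra.
Qed.

(** If f has slope g and the identity slope c <> 0 relative to l, then f has
    derivative g / c; l itself need not be continuous. *)
Lemma slope_quotient (R : realType) (V : normedModType R) (f : R -> V)
    (l : R -> R) (a b t : R) (g : V) (c : R) :
  a < t -> t < b -> c != 0 -> 
  (forall u v, a <= u -> u <= v -> v <= b -> l u <= l v) ->
  (forall lam, 0 < lam -> slope_at f l t lam g) ->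
  (forall lam, 0 < lam -> slope_at (id : R -> R^o) l t lam c) ->
  has_deriv_from a f t (c^-1 *: g).
Proof.
move=> at_ tb c0 lle fg ic e e0.
have nc : 0 < `|c| by rewrite normr_gt0.
pose K := 1 + `|g| / `|c|.
have K0 : 0 < K by rewrite ltr_wpDr // divr_ge0.
have [lam [lam0 lam1 lam2]] : exists lam, [/\ 0 < lam, lam <= `|c| / 2 &
    lam * K <= e * `|c| / 2].
  exists (Num.min (`|c| / 2) (e * `|c| / 2 / K)).
  split; last by rewrite -ler_pdivlMr // ge_min lexx orbT.
    by rewrite lt_min !divr_gt0 // mulr_gt0.
  by rewrite ge_min lexx.
have [d1 d10 H1] := fg lam lam0; have [d2 d20 H2] := ic lam lam0.
have [d [d0 dd1 dd2 da db]] : exists d,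
    [/\ 0 < d, d <= d1, d <= d2, d <= t - a & d <= b - t].
  exists (Num.min (Num.min d1 d2) (Num.min (t - a) (b - t))).
  by rewrite !lt_min d10 d20 !subr_gt0 at_ tb !ge_min !lexx ?orbT.
have main u v : t - d < u -> u <= t -> t <= v -> v < t + d ->
    `|f v - f u - (v - u) *: (c^-1 *: g)| <= e * (v - u).
  move=> tu ut tv vt.
  have uv := le_trans ut tv.
  have luv : l u <= l v by apply: lle => //; lra.
  have {}H1 : `|f v - f u - (l v - l u) *: g| <= lam * (l v - l u).
    by apply: H1 => //; lra.
  have {}H2 : `|v - u - (l v - l u) * c| <= lam * (l v - l u).
    by apply: H2 => //; lra.
  have Y0 : 0 <= l v - l u by lra.
  move: (l v - l u) (f v - f u) H1 H2 Y0 => Y X H1 H2 Y0.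
  have T0 : 0 <= v - u by lra.
  move: (v - u) T0 H2 => T T0 H2.
  have Yc : Y * `|c| <= 2 * T.
    have : Y * `|c| <= T + lam * Y.
      rewrite -(ger0_norm Y0) -normrM -[X in X + _](ger0_norm T0) (ger0_norm Y0).
      have := ler_distD T (Y * c) 0; rewrite !subr0 (distrC _ T); lra.
    have : lam * Y <= `|c| / 2 * Y by rewrite ler_wpM2r.
    lra.
  have G : `|Y *: g - T *: (c^-1 *: g)| <= lam * Y * (`|g| / `|c|).
    have -> : Y *: g - T *: (c^-1 *: g) = (- (T - Y * c) * c^-1) *: g.
      by rewrite scalerA -scalerBl; congr (_ *: _); field.
    rewrite normrZ normrM normrN normfV -[leLHS]mulrA (mulrC `|c|^-1).
    by rewrite ler_wpM2r // divr_ge0.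
  have := ler_distD (Y *: g) X (T *: (c^-1 *: g)).
  have : lam * Y + lam * Y * (`|g| / `|c|) <= e * T.
    have -> : lam * Y + lam * Y * (`|g| / `|c|) = lam * K * Y by rewrite /K; ring.
    apply: (@le_trans _ _ (e * `|c| / 2 * Y)); first by rewrite ler_wpM2r.
    have := ler_wpM2l (ltW e0) Yc; lra.
  lra.
exists d => // y ay yd.
move: yd; rewrite ltr_norml => /andP[y1 y2].
have [ty|yt] := leP t y.
  rewrite [X in _ * X]ger0_norm; last lra.
  by apply: main; lra.
have -> : f y - f t - (y - t) *: (c^-1 *: g) =
    - (f t - f y - (t - y) *: (c^-1 *: g)).
  by rewrite !opprB -(opprB t y) scaleNr opprK addrC.
rewrite normrN (distrC y) [X in _ * X]ger0_norm; last lra.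
by apply: main; lra.
Qed.

(** Absolutely continuous functions with values in a Hilbert space are
    differentiable almost everywhere. *)
Theorem ac_ae_has_deriv (R : realType) (V : completeNormedModType R)
    (ip : V -> V -> R) (f : R -> V) (a b : R) : inner_product ip -> a <= b ->
  abs_continuous a b f ->
  (@lebesgue_measure R).-negligible
    [set t | a < t < b /\ ~ exists L, has_deriv_from a f t L].
Proof.
move=> ipP ab acf; have [B fB] := ac_bounded_variation ab acf.
have [w [fw _ _]] := chain_majorant ab fB.
pose l t := t + w t.
have lE u v : a <= u -> u <= v -> v <= b -> v - u <= l v - l u.
  move=> au uv vb; have := fw u v au uv vb; have := normr_ge0 (f v - f u).
  rewrite /l; lra.
have fl u v : a <= u -> u <= v -> v <= b -> `|f v - f u| <= l v - l u.
  move=> au uv vb; have := fw u v au uv vb; rewrite /l; lra.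
have il u v : a <= u -> u <= v -> v <= b ->
    `|(v : R^o) - u| <= l v - l u.
  by move=> au uv vb; rewrite ger0_norm ?subr_ge0 // lE.
have lt u v : a <= u -> u < v -> v <= b -> l u < l v.
  move=> au uv vb; have := lE u v au (ltW uv) vb; lra.
have lle u v : a <= u -> u <= v -> v <= b -> l u <= l v.
  move=> au uv vb; have := lE u v au uv vb; lra.
have ipR : inner_product (fun x y : R^o => x * y : R).
  split => [x|x y|x y z|c x z] //=.
  - by rewrite real_normK ?num_real // expr2.
  - exact: mulrC.
  - exact: mulrBl.
  - by rewrite mulrA.
pose Nf k := [set t | a < t < b /\ forall m, ~ slope_at f l t k.+1%:R^-1 m].
pose Ni k :=
  [set t | a < t < b /\ forall m, ~ slope_at (id : R -> R^o) l t k.+1%:R^-1 m].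
have nN : (@lebesgue_measure R).-negligible
    ((\bigcup_k Nf k `|` \bigcup_k Ni k) `|` [set t | a < t < b /\
    forall lam : R, 0 < lam -> slope_at (id : R -> R^o) l t lam 0]).
  apply: negligibleU; last exact: degenerate_slope_negligible.
  apply: negligibleU; apply: negligible_bigcup => k.
  - by apply: (slope_ae ipP ab lE fl); rewrite invr_gt0.
  - by apply: (slope_ae ipR ab lE il); rewrite invr_gt0.
apply: negligibleS nN.
move=> t [/andP[at_ tb] nL]; apply: contrapT.
move=> /not_orP[/not_orP[tf ti] tz]; apply: nL.
have [|g gP] := @slope_limit _ _ f l a b t at_ tb lt.
  move=> k; apply: contrapT => /forallNP nk; apply: tf.
  by exists k => //; split; rewrite ?at_.
have [|c cP] := @slope_limit _ R^o id l a b t at_ tb lt.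
  move=> k; apply: contrapT => /forallNP nk; apply: ti.
  by exists k => //; split; rewrite ?at_.
have c0 : c != 0.
  apply/eqP => c0; apply: tz; split; first by rewrite at_.
  by move=> lam lam0; have := cP lam lam0; rewrite c0.
exists (c^-1 *: g); exact: (slope_quotient at_ tb c0 lle gP cP).
Qed.

(** * Calculus of relative derivatives *)

Lemma has_deriv_fromP (R : realType) (V : normedModType R) (s0 s : R)
    (f : R -> V) (L : V) : s0 <= s ->
  has_deriv_from s0 f s L <-> derivable_from s0 f s /\ derive_from s0 f s = L.
Proof.
move=> s0s.
pose Fi := within [set h | s0 <= h + s] (0 : R)^'.
have PF : ProperFilter Fi.
  apply: Build_ProperFilter => /nbhs_ballP[e /= e0 eP].
  apply: (eP (e / 2)) => /=.
  - by rewrite /ball /= sub0r normrN gtr0_norm //; lra.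
  - by rewrite gt_eqF //; lra.
  - by lra.
have FP : has_deriv_from s0 f s L <->
    (fun h : R => h^-1 *: (f (h + s) - f s)) @ Fi --> L.
  split.
  - move=> H; apply/cvgrPdist_le => e e0; have [d d0 dP] := H e e0.
    apply/nbhs_ballP; exists d => //= h.
    rewrite /ball /= sub0r normrN => hd h0 hs.
    have := dP (h + s) hs; rewrite addrK => /(_ hd) K.
    have n0 : 0 < `|h| by rewrite normr_gt0.
    have -> : L - h^-1 *: (f (h + s) - f s) =
        - (h^-1 *: (f (h + s) - f s - h *: L)).
      by rewrite [in RHS]scalerBr scalerA mulVf // scale1r opprB.
    by rewrite normrN normrZ normfV ler_pdivrMl // mulrC.
  - move=> /cvgrPdist_le H e e0.
    have /nbhs_ballP[d /= d0 dP] := H e e0.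
    exists d => // y s0y yd.
    have [->|ys] := eqVneq y s; first by rewrite !subrr scale0r subrr !normr0 mulr0.
    have := dP (y - s); rewrite /= subrK /ball /= sub0r normrN subr_eq0.
    move=> /(_ yd ys s0y) => K.
    have n0 : 0 < `|y - s| by rewrite normr_gt0 subr_eq0.
    have -> : f y - f s - (y - s) *: L =
        - ((y - s) *: (L - (y - s)^-1 *: (f y - f s))).
      by rewrite [in RHS]scalerBr scalerA divff ?subr_eq0 // scale1r opprB.
    by rewrite normrN normrZ mulrC ler_wpM2r.
split.
- move=> /FP H; split; first by apply/cvg_ex; exists L.
  exact: (cvg_lim (@norm_hausdorff _ _) H).
- by move=> [H HL]; apply/FP; rewrite -HL.
Qed.

Section has_deriv_calculus.
Variables (R : realType) (s0 s : R).
Implicit Types (V : normedModType R).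

Lemma has_deriv_from_lip V (f : R -> V) L : has_deriv_from s0 f s L ->
  exists2 d, 0 < d & forall y, s0 <= y -> `|y - s| < d ->
    `|f y - f s| <= (`|L| + 1) * `|y - s|.
Proof.
move=> H; have [d d0 dP] := H 1 ltr01; exists d => // y sy yd.
have := dP y sy yd; have := ler_normD (f y - f s - (y - s) *: L) ((y - s) *: L).
rewrite subrK normrZ; lra.
Qed.

Lemma has_deriv_from_ext V (f g : R -> V) L : s0 <= s ->
  (forall y, s0 <= y -> f y = g y) ->
  has_deriv_from s0 f s L -> has_deriv_from s0 g s L.
Proof.
move=> s0s fg H e e0; have [d d0 dP] := H e e0; exists d => // y sy yd.
by rewrite -!fg //; exact: dP.
Qed.

Lemma has_deriv_from_cst V (c : V) : has_deriv_from s0 (fun=> c) s 0.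
Proof.
move=> e e0; exists 1 => // y _ _.
by rewrite subrr scaler0 subrr normr0 mulr_ge0 // ltW.
Qed.

Lemma has_deriv_from_id : has_deriv_from s0 (fun y : R => y : R^o) s (1 : R^o).
Proof.
move=> e e0; exists 1 => // y _ _.
have -> : (y - s) *: (1 : R^o) = y - s by rewrite -[RHS]mulr1.
by rewrite subrr normr0 mulr_ge0 // ltW.
Qed.

Lemma has_deriv_fromD V (f g : R -> V) L L' :
  has_deriv_from s0 f s L -> has_deriv_from s0 g s L' ->
  has_deriv_from s0 (fun y => f y + g y) s (L + L').
Proof.
move=> Hf Hg e e0.
have [d1 d10 H1] := Hf (e / 2) ltac:(lra).
have [d2 d20 H2] := Hg (e / 2) ltac:(lra).
exists (Num.min d1 d2); first by rewrite lt_min d10.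
move=> y sy; rewrite lt_min => /andP[y1 y2].
have -> : f y + g y - (f s + g s) - (y - s) *: (L + L') =
    (f y - f s - (y - s) *: L) + (g y - g s - (y - s) *: L').
  by rewrite scalerDr !opprD (addrACA (f y) (g y) (- f s)) [LHS]addrACA.
have := ler_normD (f y - f s - (y - s) *: L) (g y - g s - (y - s) *: L').
have := H1 y sy y1; have := H2 y sy y2; lra.
Qed.

Lemma has_deriv_fromZ V (a : R -> R) (f : R -> V) (a' : R) L : 
  has_deriv_from s0 (a : R -> R^o) s a' -> has_deriv_from s0 f s L ->
  has_deriv_from s0 (fun y => a y *: f y) s (a' *: f s + a s *: L).
Proof.
move=> Ha Hf e e0.
pose C := (`|a'| + 1) * (`|L| + 1).
have C0 : 0 < C by rewrite mulr_gt0 // ltr_wpDl.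
have N1 : 0 < `|f s| + 1 by rewrite ltr_wpDl.
have N2 : 0 < `|a s| + 1 by rewrite ltr_wpDl.
have e1 : 0 < e / 3 / (`|f s| + 1) by rewrite !divr_gt0.
have e2 : 0 < e / 3 / (`|a s| + 1) by rewrite !divr_gt0.
have e3 : 0 < e / 3 / C by rewrite !divr_gt0.
have [d1 d10 H1] := Ha _ e1.
have [d2 d20 H2] := Hf _ e2.
have [d3 d30 H3] := has_deriv_from_lip Ha.
have [d4 d40 H4] := has_deriv_from_lip Hf.
exists (Num.min (Num.min (Num.min d1 d2) (Num.min d3 d4)) (e / 3 / C)).
  by rewrite !lt_min d10 d20 d30 d40.
move=> y sy; rewrite !lt_min => /andP[/andP[/andP[y1 y2] /andP[y3 y4]] y5].
have -> : a y *: f y - a s *: f s - (y - s) *: (a' *: f s + a s *: L) =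
    (a y - a s - (y - s) * a') *: f s + a s *: (f y - f s - (y - s) *: L)
    + (a y - a s) *: (f y - f s).
  have E1 : a y *: f y - a s *: f s = (a y - a s) *: f s
      + (a y - a s) *: (f y - f s) + a s *: (f y - f s).
    rewrite -scalerDr [f s + _]addrC subrK scalerBl [a s *: (_ - _)]scalerBr.
    by rewrite addrA subrK.
  rewrite E1 [(_ - _ * a') *: _]scalerBl [a s *: (_ - _ *: L)]scalerBr.
  rewrite (scalerDr (y - s)) !scalerA (mulrC (a s)) opprD !addrA.
  by rewrite [RHS](ACl (1*5*3*2*4))/=.
have {}H1 := H1 y sy y1; have {}H2 := H2 y sy y2.
have {}H3 := H3 y sy y3; have {}H4 := H4 y sy y4.
have h0 := normr_ge0 (y - s).
move: (`|y - s|) h0 H1 H2 H3 H4 y5 {y1 y2 y3 y4} => h h0 H1 H2 H3 H4 y5.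
have T1 : `|(a y - a s - (y - s) * a') *: f s| <= e / 3 * h.
  rewrite normrZ; apply: (le_trans (ler_wpM2r (normr_ge0 _) H1)).
  have := ler_wpM2l (mulr_ge0 (ltW e1) h0) (_ : `|f s| <= `|f s| + 1).
  rewrite lerDl => /(_ ler01) /le_trans; apply.
  by rewrite mulrAC divfK // gt_eqF.
have T2 : `|a s *: (f y - f s - (y - s) *: L)| <= e / 3 * h.
  rewrite normrZ; apply: (le_trans (ler_wpM2l (normr_ge0 _) H2)).
  have := ler_wpM2l (mulr_ge0 (ltW e2) h0) (_ : `|a s| <= `|a s| + 1).
  rewrite lerDl [in X in _ -> X]mulrC => /(_ ler01) /le_trans; apply.
  by rewrite mulrAC divfK // gt_eqF.
have T3 : `|(a y - a s) *: (f y - f s)| <= e / 3 * h.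
  rewrite normrZ; apply: (le_trans (ler_pM _ _ H3 H4)) => //.
  have -> : (`|a'| + 1) * h * ((`|L| + 1) * h) = C * h * h by rewrite /C; ring.
  rewrite ler_wpM2r // mulrC -ler_pdivlMr //; exact: ltW.
apply: (le_trans (ler_normD _ _)); apply: (@le_trans _ _ (e / 3 * h + e / 3 * h + e / 3 * h)).
  by rewrite lerD // (le_trans (ler_normD _ _)) // lerD.
lra.
Qed.

Lemma has_deriv_from_inv : 0 < s0 -> s0 <= s ->
  has_deriv_from s0 (fun y : R => y^-1 : R^o) s (- (s ^- 2) : R^o).
Proof.
move=> s00 s0s e e0.
have s1 : 0 < s by lra.
pose C := s0 * s ^+ 2.
have C0 : 0 < C by rewrite mulr_gt0 // exprn_gt0.
exists (e * C) => [|y sy yd]; first exact: mulr_gt0.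
have y0 : 0 < y by lra.
have -> : y^-1 - s^-1 - (y - s) *: (- s ^- 2 : R^o) = (y - s) ^+ 2 / (y * s ^+ 2).
  rewrite -[_ *: _]/((y - s) * - s ^- 2); field.
  by rewrite !gt_eqF.
rewrite normrM normfV normrX (gtr0_norm (mulr_gt0 y0 (exprn_gt0 2 s1))).
rewrite ler_pdivrMr ?mulr_gt0 ?exprn_gt0 //.
rewrite expr2 mulrAC; apply: ler_wpM2r => //.
apply: (le_trans (ltW yd)); rewrite ler_pM2l // /C ler_wpM2r // ltW //.
exact: exprn_gt0.
Qed.

End has_deriv_calculus.

(** * Calculus of absolutely continuous functions *)

Section abs_continuous_calculus.
Variables (R : realType) (a b : R).
Implicit Types (V : normedModType R).

Lemma abs_continuous_ext V (f g : R -> V) :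
  (forall t, a <= t -> t <= b -> f t = g t) ->
  abs_continuous a b f -> abs_continuous a b g.
Proof.
move=> fg H e e0; have [d d0 dP] := H e e0; exists d => // n u v uv tuv suv.
rewrite (eq_bigr (fun i => `|f (v i) - f (u i)|)); first exact: dP.
move=> i _; have [au ui vb] := uv i.
by rewrite !fg // ?(le_trans au) // (le_trans ui).
Qed.

Lemma abs_continuous_sub V (f : R -> V) (x y : R) : a <= x -> y <= b ->
  abs_continuous a b f -> abs_continuous x y f.
Proof.
move=> ax yb H e e0; have [d d0 dP] := H e e0; exists d => // n u v uv.
apply: dP => i; have [xu ui vy] := uv i.
by split=> //; [exact: le_trans xu | exact: le_trans yb].
Qed.

Lemma abs_continuous_lipschitz V (f : R -> V) (K : R) :
  (forall u v, a <= u -> u <= v -> v <= b -> `|f v - f u| <= K * (v - u)) ->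
  abs_continuous a b f.
Proof.
move=> fK e e0.
have N0 : 0 < `|K| + 1 by rewrite ltr_wpDl.
exists (e / (`|K| + 1)) => [|n u v uv _]; first exact: divr_gt0.
rewrite ltr_pdivlMr // mulrC => /(le_lt_trans _); apply.
rewrite mulr_sumr; apply: ler_sum => i _; have [au ui vb] := uv i.
apply: (le_trans (fK _ _ au ui vb)); rewrite ler_wpM2r ?subr_ge0 //.
by rewrite (le_trans (ler_norm _)) // lerDl.
Qed.

Lemma abs_continuousD V (f g : R -> V) :
  abs_continuous a b f -> abs_continuous a b g ->
  abs_continuous a b (fun t => f t + g t).
Proof.
move=> Hf Hg e e0.
have [d1 d10 H1] := Hf (e / 2) ltac:(lra).
have [d2 d20 H2] := Hg (e / 2) ltac:(lra).
exists (Num.min d1 d2) => [|n u v uv tuv]; first by rewrite lt_min d10.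
rewrite lt_min => /andP[s1 s2].
have {}H1 := H1 n u v uv tuv s1; have {}H2 := H2 n u v uv tuv s2.
apply: (@le_lt_trans _ _ (\sum_(i < n) `|f (v i) - f (u i)| +
  \sum_(i < n) `|g (v i) - g (u i)|)); last lra.
rewrite -big_split; apply: ler_sum => i _ /=.
by rewrite opprD addrACA; exact: ler_normD.
Qed.

Lemma abs_continuous_bounded V (f : R -> V) : a <= b -> abs_continuous a b f ->
  exists2 B, 0 < B & forall t, a <= t -> t <= b -> `|f t| <= B.
Proof.
move=> ab /(ac_bounded_variation ab)[B HB].
have B0 : 0 <= B by have := HB [::]; apply.
exists (`|f a| + B + 1) => [|t at_ tb]; first by have := normr_ge0 (f a); lra.
have := HB [:: t]; rewrite /= at_ addr0 => /(_ isT tb).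
have := ler_normD (f t - f a) (f a); rewrite subrK; lra.
Qed.

Lemma abs_continuousZ V (c : R -> R) (f : R -> V) : a <= b ->
  abs_continuous a b (c : R -> R^o) -> abs_continuous a b f ->
  abs_continuous a b (fun t => c t *: f t).
Proof.
move=> ab Hc Hf e e0.
have [C C0 CP] := abs_continuous_bounded ab Hc.
have [F F0 FP] := abs_continuous_bounded ab Hf.
have [d1 d10 H1] := Hc (e / 2 / F) ltac:(by rewrite !divr_gt0).
have [d2 d20 H2] := Hf (e / 2 / C) ltac:(by rewrite !divr_gt0).
exists (Num.min d1 d2) => [|n u v uv tuv]; first by rewrite lt_min d10.
rewrite lt_min => /andP[s1 s2].
have := H1 n u v uv tuv s1; have := H2 n u v uv tuv s2.
rewrite !ltr_pdivlMr // => {}H2 {}H1.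
apply: (@le_lt_trans _ _ ((\sum_(i < n) `|c (v i) - c (u i)|) * F +
  (\sum_(i < n) `|f (v i) - f (u i)|) * C)); last lra.
rewrite !mulr_suml -big_split; apply: ler_sum => i _ /=.
have [au ui vb] := uv i.
have av := le_trans au ui; have ub := le_trans ui vb.
have -> : c (v i) *: f (v i) - c (u i) *: f (u i) =
    (c (v i) - c (u i)) *: f (v i) + c (u i) *: (f (v i) - f (u i)).
  by rewrite scalerBl scalerBr addrA subrK.
apply: (le_trans (ler_normD _ _)); rewrite !normrZ lerD //.
  by rewrite ler_wpM2l // FP.
by rewrite mulrC ler_wpM2l // CP.
Qed.

Lemma abs_continuous_near V (f : R -> V) : abs_continuous a b f ->
  forall e, 0 < e -> exists2 d, 0 < d & forall s t, a <= s -> s <= b ->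
    a <= t -> t <= b -> `|t - s| < d -> `|f t - f s| < e.
Proof.
move=> H e e0; have [d d0 dP] := H e e0; exists d => // s t.
wlog st : s t / s <= t.
  move=> wl as_ sb at_ tb ts; have [le|/ltW le] := leP s t; first exact: wl.
  by rewrite distrC; apply: wl => //; rewrite distrC.
move=> as_ sb at_ tb ts.
have := dP 1%N (fun=> s) (fun=> t); rewrite !big_ord1; apply => //.
  by move=> i j _ _ _; rewrite !ord1.
by rewrite -(ger0_norm (_ : 0 <= t - s)) // subr_ge0.
Qed.

End abs_continuous_calculus.

Lemma lebesgue_aeS (R : realType) (P Q : R -> Prop) :
  (forall t, P t -> Q t) ->
  {ae @lebesgue_measure R, forall t, P t} ->
  {ae @lebesgue_measure R, forall t, Q t}.
Proof. by move=> PQ; apply: negligibleS => t /= nQ /PQ. Qed.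

Lemma ac_ae_deriv0 (R : realType) (V : normedModType R) (f : R -> V) (a b : R) :
  a <= b -> abs_continuous a b f ->
  {ae @lebesgue_measure R, forall t, a <= t -> has_deriv_from a f t 0} ->
  f b = f a.
Proof.
move=> ab acf H; apply/eqP; rewrite -subr_eq0 -normr_le0.
rewrite -(mul0r (b - a)); apply: ac_ae_lipschitz => //.
apply: lebesgue_aeS H => t H at_ tb e e0.
have [d d0 dP] := H at_ e e0; exists d => // y ay yb yd.
by have := dP y ay yd; rewrite scaler0 subr0 add0r.
Qed.

(** The mean value inequality is applied to y |-> f(y) - y g(t), whose derivative
    g - g(t) is small near t. *)
Lemma ac_ae_deriv_everywhere (R : realType) (V : normedModType R)
    (f g : R -> V) (a : R) :
  loc_abs_continuous a f -> loc_abs_continuous a g ->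
  {ae @lebesgue_measure R, forall t, a <= t -> has_deriv_from a f t (g t)} ->
  forall t, a <= t -> has_deriv_from a f t (g t).
Proof.
move=> acf acg H t at_ e e0.
have acg1 : abs_continuous a (t + 1) g by apply: acg; lra.
have [d d0 dP] := abs_continuous_near acg1 e0.
pose d' := Num.min d 1.
have d'0 : 0 < d' by rewrite lt_min d0 ltr01.
have d'd : d' <= d by rewrite ge_min lexx.
have d'1 : d' <= 1 by rewrite ge_min lexx orbT.
have main u v : a <= u -> u <= v -> t - d' < u -> u <= t -> t <= v -> v < t + d' ->
    `|f v - f u - (v - u) *: g t| <= e * (v - u).
  move=> au uv tu ut tv vt.
  have fE x y : f y - f x - (y - x) *: g t =
      (f y + (- y) *: g t) - (f x + (- x) *: g t).
    by rewrite scalerBl !scaleNr !opprB addrACA [RHS]addrACA [- f x - _]addrC.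
  rewrite fE.
  apply: (@ac_ae_lipschitz _ _ (fun y => f y + (- y) *: g t)) => //.
  - exact: ltW.
  - apply: abs_continuousD.
      apply: (@abs_continuous_sub _ a v) => //.
      by apply: acf; lra.
    apply: (@abs_continuous_lipschitz _ _ _ _ _ `|g t|) => x y ux xy yv.
    rewrite -scalerBl normrZ opprK addrC -opprB normrN.
    by rewrite ger0_norm ?subr_ge0 // mulrC.
  apply: lebesgue_aeS H => s H us sv e' e'0.
  have as_ : a <= s by lra.
  have [d1 d10 H1] := H as_ e' e'0; exists d1 => // y uy yv yd.
  have {}H1 := H1 y (le_trans au uy) yd.
  have gst : `|g s - g t| < e.
    apply: dP => //; try lra.
    by rewrite ltr_norml; apply/andP; split; lra.
  have -> : f y + - y *: g t - (f s + - s *: g t) =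
      (f y - f s - (y - s) *: g s) + (y - s) *: (g s - g t).
    by rewrite scalerBr addrA subrK fE.
  apply: (le_trans (ler_normD _ _)); rewrite normrZ.
  have : `|y - s| * `|g s - g t| <= `|y - s| * e by rewrite ler_wpM2l // ltW.
  lra.
exists d' => // y ay; rewrite ltr_norml => /andP[y1 y2].
have [ty|yt] := leP t y.
  rewrite [X in _ * X]ger0_norm; last lra.
  by apply: main; lra.
have -> : f y - f t - (y - t) *: g t = - (f t - f y - (t - y) *: g t).
  by rewrite !opprB -(opprB t y) scaleNr opprK addrC.
rewrite normrN (distrC y) [X in _ * X]ger0_norm; last lra.
by apply: main; lra.
Qed.

Lemma C1_loc_abs_continuous (R : realType) (s0 : R) (f : R -> R) : C1_from s0 f ->
  loc_abs_continuous s0 (f : R -> R^o).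
Proof.
move=> [df cf] S s0S.
pose D := derive_from s0 f.
have cD : {within `[s0, S], continuous D}.
  by apply: continuous_subspaceW cf; apply: subset_itvl; rewrite bnd_simp.
have [c1 _ D1] := EVT_max s0S cD; have [c2 _ D2] := EVT_min s0S cD.
pose K := `|D c1| + `|D c2|.
have DK t : s0 <= t -> t <= S -> `|D t| <= K.
  move=> at_ tS; have tI : t \in `[s0, S] by rewrite in_itv /= at_.
  have := D1 t tI; have := D2 t tI; rewrite /K.
  have := ler_norm (D c1); have := ler_norm (- D c2); rewrite normrN.
  have := normr_ge0 (D c1); have := normr_ge0 (D c2).
  by move=> *; rewrite ler_norml; apply/andP; split; lra.
apply: (@abs_continuous_lipschitz _ _ _ _ _ (K + 1)) => u v au uv vS.
apply: (@local_to_global _ (fun u v => `|(f v : R^o) - f u| <= (K + 1) * (v - u))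
  u v) => //.
  move=> x y z _ _ xy yz.
  by have := ler_distD (f y : R^o) (f z) (f x); lra.
move=> t ut tv.
have at_ : s0 <= t by lra.
have tS : t <= S by lra.
have Ht : has_deriv_from s0 (f : R -> R^o) t (D t).
  by apply/has_deriv_fromP => //; split => //; exact: df.
have [d d0 dP] := has_deriv_from_lip Ht.
have {dP} dP y : s0 <= y -> `|y - t| < d -> `|(f y : R^o) - f t| <= (K + 1) * `|y - t|.
  move=> sy yd; apply: (le_trans (dP y sy yd)).
  by rewrite ler_wpM2r // lerD2r DK.
exists d => // x y ux tx xt ty yt yv.
have P1 := dP x ltac:(lra) ltac:(rewrite ltr_norml; apply/andP; split; lra).
have P2 := dP y ltac:(lra) ltac:(rewrite ltr_norml; apply/andP; split; lra).
have := ler_distD (f t : R^o) (f y) (f x).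
move: P1 P2; rewrite [`|x - t|]distrC (distrC (f x : R^o)).
rewrite [`|t - x|]ger0_norm ?subr_ge0 // [`|y - t|]ger0_norm ?subr_ge0 //.
lra.
Qed.

(** * Equivalence of the two systems *)

Lemma inner_product_dot (R : realType) (H : completeNormedModType R)
    (dot : {dot H for idfun}) : (forall x : H, `|x| ^+ 2 = dot x x) ->
  inner_product (fun x y => dot x y).
Proof.
move=> dotN; split => //.
- by move=> x y; rewrite hermitian_subproof expr0 mul1r.
- by move=> x y w; exact: zmod_morphisml_subproof.
- by move=> c x w; exact: linearl_subproof.
Qed.

Lemma loc_ac_ae_has_deriv (R : realType) (V : completeNormedModType R)
    (ip : V -> V -> R) (f : R -> V) (s0 : R) : inner_product ip ->
  loc_abs_continuous s0 f ->
  {ae @lebesgue_measure R, forall t, s0 <= t -> exists L, has_deriv_from s0 f t L}.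
Proof.
move=> ipP acf.
pose N (n : nat) := [set t | s0 < t < s0 + n%:R /\ ~ exists L, has_deriv_from s0 f t L].
have Nn n : (@lebesgue_measure R).-negligible (N n).
  have s0n : s0 <= s0 + n%:R by rewrite lerDl.
  exact: (ac_ae_has_deriv ipP s0n (acf _ s0n)).
(* the end point s0 is discarded as negligible *)
have N1 : (@lebesgue_measure R).-negligible [set s0].
  by apply/negligible_outer_measure; exact: (countable_lebesgue_measure0 (countable1 s0)).
have := negligibleU (negligible_bigcup Nn) N1; apply: negligibleS => t /= nt.
have [s0t tL] : s0 <= t /\ ~ exists L, has_deriv_from s0 f t L.
  by split; [|move=> tL]; apply: contrapT => H; apply: nt.
have [->|ts] := eqVneq t s0; first by right.
left; exists (Num.bound (t - s0)) => //; split => //.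
rewrite lt_neqAle eq_sym ts s0t /= -ltrBlDl.
by apply: archi_boundP; rewrite subr_ge0.
Qed.

Section equivalence.
Variables (R : realType) (H : completeNormedModType R).
Variables (M : H -> H) (s0 alpha : R) (beta : R -> R).
Hypothesis s00 : 0 < s0.
Hypothesis alpha1 : 1 < alpha.
Hypothesis betaC1 : C1_from s0 beta.

Let id_ac : loc_abs_continuous s0 (fun s : R => s : R^o).
Proof.
move=> S _; apply: (@abs_continuous_lipschitz _ _ _ _ _ 1) => u v _ uv _.
by rewrite mul1r ger0_norm // subr_ge0.
Qed.

Let beta_deriv s : s0 <= s ->
  has_deriv_from s0 (beta : R -> R^o) s (derive_from s0 beta s).
Proof. by move=> s0s; apply/has_deriv_fromP => //; split => //; exact: betaC1.1. Qed.

Let beta_ac : loc_abs_continuous s0 (beta : R -> R^o).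
Proof. exact: C1_loc_abs_continuous. Qed.

(** A conserved quantity of the second-order system. *)
Lemma first_integral (z : R -> H) (z0 dz0 : H) :
  strong_solution2 M alpha beta s0 z0 dz0 z -> forall s, s0 <= s ->
  s *: derive_from s0 z s + (s * beta s) *: M (z s) + (alpha - 1) *: z s =
  s0 *: dz0 + (s0 * beta s0) *: M z0 + (alpha - 1) *: z0.
Proof.
move=> sol s s0s; rewrite -(sol2_init sol) -(sol2_derive_init sol).
pose F t := t *: derive_from s0 z t + (t * beta t) *: M (z t) + (alpha - 1) *: z t.
rewrite -[LHS]/(F s) -[RHS]/(F s0); apply: (ac_ae_deriv0 s0s).
  apply: abs_continuousD; last first.
    apply: (abs_continuousZ s0s (c := fun=> alpha - 1)); last exact: sol2_ac sol _ s0s.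
    apply: (@abs_continuous_lipschitz _ _ _ _ _ 0) => u v _ _ _.
    by rewrite subrr normr0 mul0r.
  apply: abs_continuousD; apply: abs_continuousZ => //.
  - exact: id_ac.
  - exact: sol2_derive_ac sol _ s0s.
  - apply: (abs_continuousZ (V := R^o)) => //; [exact: id_ac|exact: beta_ac].
  - exact: sol2_op_ac sol _ s0s.
apply: lebesgue_aeS (sol2_eq sol) => t Ht s0t; have [d2z dM eqt] := Ht s0t.
have t0 : t != 0 by rewrite gt_eqF // (lt_le_trans s00).
have h1 : has_deriv_from s0 z t (derive_from s0 z t).
  by apply/has_deriv_fromP => //; split => //; exact: sol2_derivable sol _ s0t.
have h2 : has_deriv_from s0 (derive_from s0 z) t
    (derive_from s0 (derive_from s0 z) t) by apply/has_deriv_fromP.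
have h3 : has_deriv_from s0 (M \o z) t (derive_from s0 (M \o z) t).
  exact/has_deriv_fromP.
have h4 := has_deriv_fromZ (has_deriv_from_id s0 t) (beta_deriv s0t).
have := has_deriv_fromD (has_deriv_fromD
  (has_deriv_fromZ (has_deriv_from_id s0 t) h2) (has_deriv_fromZ h4 h3))
  (has_deriv_fromZ (has_deriv_from_cst s0 t (alpha - 1 : R^o)) h1).
set L := (X in has_deriv_from _ _ _ X -> _).
suff -> : L = 0 by [].
rewrite -(scaler0 _ t) -eqt /L /=.
move: (derive_from s0 (derive_from s0 z) t) (derive_from s0 z t) => a b.
move: (derive_from s0 (M \o z) t) (M (z t)) (z t) => m p x.
rewrite !scale1r scale0r add0r !scalerDr !scalerA.
rewrite -![_ *: (_ : R^o)]/(_ * _).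
have -> : t * (alpha / t) = 1 + (alpha - 1) by field.
have -> : t * (derive_from s0 beta t + beta t / t) =
  beta t + t * derive_from s0 beta t by field.
by rewrite [(1 + _) *: b]scalerDl scale1r !addrA [LHS](ACl (2*1*5*4*3))/=.
Qed.

(** The anchor point, for initial position x, initial velocity d and p = M(x). *)
Let anchor (x d p : H) := x + (s0 / (alpha - 1)) *: (d + beta s0 *: p).

Let alpha1_neq0 : alpha - 1 != 0.
Proof. by rewrite subr_eq0 gt_eqF. Qed.

Lemma anchorE (x d p : H) : (alpha - 1) *: anchor x d p =
  s0 *: d + (s0 * beta s0) *: p + (alpha - 1) *: x.
Proof.
by rewrite /anchor scalerDr scalerA mulrCA divff // mulr1 scalerDr scalerA addrC.
Qed.

Lemma solution2_solution1 (z : R -> H) (z0 dz0 : H) :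
  strong_solution2 M alpha beta s0 z0 dz0 z ->
  strong_solution1 M alpha beta s0 (anchor z0 dz0 (M z0)) z0 z.
Proof.
move=> sol; split.
- exact: sol2_ac sol.
- exact: sol2_op_ac sol.
- apply: aeW => s s0s; split; first exact: sol2_derivable sol _ s0s.
  have sn0 : s != 0 by rewrite gt_eqF // (lt_le_trans s00).
  have := first_integral sol s0s; rewrite -anchorE => E.
  apply: (scalerI sn0).
  rewrite scaler0 !scalerDr !scalerA mulrCA divff // mulr1 scalerN addrA.
  by rewrite E subrr.
- exact: sol2_init sol.
Qed.

Lemma solution1_solution2 (ip : H -> H -> R) (z : R -> H) (z0 dz0 : H) :
  inner_product ip ->
  strong_solution1 M alpha beta s0 (anchor z0 dz0 (M z0)) z0 z ->
  strong_solution2 M alpha beta s0 z0 dz0 z.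
Proof.
move=> ipP sol; set v := anchor _ _ _ in sol.
pose g s := (-1 * beta s) *: M (z s) + (- (alpha - 1) / s) *: (z s - v).
have inv_ac : loc_abs_continuous s0 (fun s : R => s^-1 : R^o).
  move=> S s0S; apply: (@abs_continuous_lipschitz _ _ _ _ _ (s0 ^- 2)).
  move=> x y s0x xy yS.
  have x0 : 0 < x by rewrite (lt_le_trans s00).
  have y0 : 0 < y by rewrite (lt_le_trans x0).
  have -> : (y^-1 : R^o) - x^-1 = - ((y - x) / (x * y)).
    by field; rewrite !gt_eqF.
  rewrite normrN ger0_norm; last by rewrite divr_ge0 ?subr_ge0 // mulr_ge0 // ltW.
  rewrite mulrC ler_wpM2r ?subr_ge0 // lef_pV2 ?posrE ?mulr_gt0 ?exprn_gt0 //.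
  by rewrite expr2 ler_pM ?(ltW s00) // (le_trans s0x).
have cst_ac (V' : normedModType R) (c : V') : loc_abs_continuous s0 (fun=> c).
  move=> S _; apply: (@abs_continuous_lipschitz _ _ _ _ _ 0) => x y _ _ _.
  by rewrite subrr normr0 mul0r.
have g_ac : loc_abs_continuous s0 g.
  move=> S s0S; apply: abs_continuousD; apply: abs_continuousZ => //.
  - apply: (abs_continuousZ (V := R^o)) => //; [exact: cst_ac|exact: beta_ac].
  - exact: sol1_op_ac sol _ s0S.
  - apply: (abs_continuousZ (V := R^o)) => //; [exact: cst_ac|exact: inv_ac].
  - apply: abs_continuousD; [exact: sol1_ac sol _ s0S|exact: cst_ac].
have z_deriv : forall s, s0 <= s -> has_deriv_from s0 z s (g s).
  apply: ac_ae_deriv_everywhere => //; first exact: sol1_ac sol.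
  apply: lebesgue_aeS (sol1_eq sol) => s Hs s0s; have [dz E] := Hs s0s.
  apply/has_deriv_fromP => //; split => //.
  by apply/eqP; rewrite -subr_eq0 -E /g mulN1r mulNr !scaleNr opprD !opprK addrA.
have dzE s : s0 <= s -> derive_from s0 z s = g s.
  by move=> s0s; have /has_deriv_fromP[] := z_deriv s s0s.
split.
- exact: sol1_ac sol.
- by move=> s s0s; have /has_deriv_fromP[] := z_deriv s s0s.
- move=> S s0S; apply: abs_continuous_ext (g_ac S s0S) => t s0t _.
  by rewrite dzE.
- exact: sol1_op_ac sol.
- apply: lebesgue_aeS (loc_ac_ae_has_deriv ipP (sol1_op_ac sol)) => t Ht s0t.
  have [m Hm] := Ht s0t; have Hz := z_deriv t s0t; have Hb := beta_deriv s0t.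
  have t0 : t != 0 by rewrite gt_eqF // (lt_le_trans s00).
  have [dM Mm] := (has_deriv_fromP _ _ s0t).1 Hm.
  have Hnb := has_deriv_fromZ (has_deriv_from_cst s0 t (-1 : R^o)) Hb.
  have Hi := has_deriv_fromZ (has_deriv_from_cst s0 t (- (alpha - 1) : R^o))
    (has_deriv_from_inv s00 s0t).
  have := has_deriv_fromD (has_deriv_fromZ Hnb Hm) (has_deriv_fromZ Hi
    (has_deriv_fromD Hz (has_deriv_from_cst s0 t (- v)))).
  set L := (X in has_deriv_from _ _ _ X -> _) => HL.
  have HL2 : has_deriv_from s0 (derive_from s0 z) t L.
    by apply: has_deriv_from_ext HL => // y s0y; rewrite dzE.
  have /has_deriv_fromP - /(_ s0t)[ddz ddzE] := HL2.
  split => //; rewrite ddzE Mm dzE // /L /= addr0.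
  have gE : g t = (-1 * beta t) *: M (z t) + (- (alpha - 1) / t) *: (z t - v).
    by [].
  move: (g t) (M (z t)) (z t - v) (derive_from s0 beta t) (beta t) gE
    => G p w b' b gE.
  rewrite !addrA [LHS](ACl ((1*7)*(2*6)*(4*5)*3))/= -!scalerDl.
  rewrite -![_ *: (_ : R^o)]/(_ * _).
  have -> : 0 * b + -1 * b' + (b' + b / t) = t^-1 * b by ring.
  have -> : -1 * b + b = 0 by ring.
  have -> : (- (alpha - 1) + alpha) / t = t^-1 by ring.
  have -> : 0 * t^-1 + - (alpha - 1) * - t ^- 2 = t^-1 * ((alpha - 1) / t).
    by field.
  rewrite scale0r addr0 -(scalerA _ b) -(scalerA _ (_ / t)) -!scalerDr gE mulN1r mulNr !scaleNr.
  by rewrite !addrA subrr add0r addNr scaler0.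
- exact: sol1_init sol.
- rewrite dzE // /g (sol1_init sol) /v /anchor (opprD z0) addrA subrr add0r.
  rewrite -scaleNr scalerA mulN1r.
  have -> : - (alpha - 1) / s0 * - (s0 / (alpha - 1)) = 1.
    by field; rewrite alpha1_neq0 gt_eqF.
  by rewrite scale1r scaleNr addrCA addNr addr0.
Qed.

End equivalence.

Theorem proposition3p1 (R : realType) (H : completeNormedModType R)
  (dot : {dot H for idfun}) (dot_norm : forall x : H, `|x| ^+ 2 = dot x x)
  (M : H -> H) (M_monotone : monotone_operator dot M)
  (M_continuous : continuous M) (Zer_nonempty : Zer M !=set0)
  (s0 : R) (s0_gt0 : 0 < s0) (alpha : R) (alpha_gt1 : 1 < alpha)
  (beta : R -> R) (beta_gt0 : forall s, s0 <= s -> 0 < beta s)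
  (beta_C1 : C1_from s0 beta) (z0 dz0 : H) (z : R -> H) :
  let v := z0 + (s0 / (alpha - 1)) *: (dz0 + beta s0 *: M z0) in
  trajectory_solution2 M alpha beta s0 z0 dz0 z <->
  trajectory_solution1 M alpha beta s0 v z0 z.
Proof.
have ipP := inner_product_dot dot_norm.
have E y := conj
  (@solution2_solution1 _ _ M _ _ _ s0_gt0 alpha_gt1 beta_C1 y z0 dz0)
  (@solution1_solution2 _ _ M _ _ _ s0_gt0 alpha_gt1 beta_C1 _ y z0 dz0 ipP).
by split=> -[/E solz uz]; split => // y /E; exact: uz.
Qed.
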